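(* Let $\alpha\in\mathbb{F}_q((z^{-1}))$ be irrational and, for $k\ge1$, let $Q_k$ be the denominator of its $k$-th convergent. Then there exists $\varepsilon>0$ such that $\mathrm{Bad}^{\varepsilon}(\alpha)$ has Hausdorff dimension $1$ if and only if $\lim_{k\to\infty}\|Q_k\|^{1/k}=\infty$.
   Context: Let $q$ be a prime power, $\mathbb{F}_q[z]$ the polynomial ring over $\mathbb{F}_q$, $\mathbb{F}_q((z^{-1}))$ the field of formal Laurent series in $z^{-1}$, with $\|x\|=q^{\deg x}$ for $x\ne0$ and $\|0\|=0$; $\alpha$ is irrational if $\alpha\notin\mathbb{F}_q(z)$. $|\langle x\rangle|=\min_{y\in\mathbb{F}_q[z]}\|x-y\|$. $\mathbb{I}=\{x:\|x\|<1\}$. For $\varepsilon>0$, $\mathrm{Bad}^{\varepsilon}(\alpha)=\{\theta\in\mathbb{I}:\liminf_{Q\in\mathbb{F}_q[z],\ \|Q\|\to\infty}\|Q\|\,|\langle Q\alpha-\theta\rangle|\ge\varepsilon\}$. Hausdorff dimension is with respect to the metric $\|x-y\|$. Continued fraction: $\alpha=A_0+1/(A_1+1/(A_2+\cdots))$ with $A_i\in\mathbb{F}_q[z]$, $\deg A_i\ge1$ for $i\ge1$ (obtained by taking polynomial parts and iterating $x\mapsto 1/x-[1/x]$); denominators of convergents are defined by $Q_{-1}=0$, $Q_0=1$, $Q_{k+1}=A_{k+1}Q_k+Q_{k-1}$. *)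

(* Defs.v *)
From HB Require Import structures.
From mathcomp Require Import all_boot all_order all_algebra.
From mathcomp Require Import zify.
From mathcomp Require Import all_classical all_reals all_analysis.
Set Implicit Arguments.
Unset Strict Implicit.
Unset Printing Implicit Defensive.
Import Order.TTheory GRing.Theory Num.Theory.
Import numFieldNormedType.Exports.
Local Open Scope classical_set_scope.
Local Open Scope ring_scope.

Section LaurentField.
Variable F : fieldType.

(* [x n] is the coefficient of z^n; the support is bounded above, so that
   x is a Laurent series in z^-1. *)
Record laurent := Laurent {
  lcoef :> int -> F;
  lcoefP : exists N : int, forall n, N < n -> lcoef n = 0 }.

HB.instance Definition _ := gen_eqMixin laurent.
HB.instance Definition _ := gen_choiceMixin laurent.

Implicit Types x y t : laurent.

Definition lbound (N : int) (x : laurent) := forall n, N < n -> x n = 0.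

Lemma laurentP x y : (forall n, x n = y n) -> x = y.
Proof.
case: x y => [f fP] [g gP] /= /funext fg; subst g.
by congr Laurent; exact: Prop_irrelevance.
Qed.

Lemma lboundW N M x : N <= M -> lbound N x -> lbound M x.
Proof. by move=> NM xN n Mn; apply: xN; apply: le_lt_trans Mn. Qed.

Lemma lbound2 x y : exists N, lbound N x /\ lbound N y.
Proof.
have [N xN] := lcoefP x; have [M yM] := lcoefP y.
exists (Num.max N M); split.
  by apply: lboundW xN; rewrite le_max lexx.
by apply: lboundW yM; rewrite le_max lexx orbT.
Qed.

Definition lzero := @Laurent (fun=> 0) (ex_intro _ 0 (fun _ _ => erefl)).

Lemma lopp_subproof x :
  exists N : int, forall n, N < n -> - x n = 0.
Proof. by have [N xN] := lcoefP x; exists N => n /xN ->; rewrite oppr0. Qed.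
Definition lopp x := Laurent (lopp_subproof x).

Lemma ladd_subproof x y :
  exists N : int, forall n, N < n -> x n + y n = 0.
Proof.
have [N [xN yN]] := lbound2 x y.
by exists N => n Nn; rewrite xN// yN// addr0.
Qed.
Definition ladd x y := Laurent (ladd_subproof x y).

Lemma laddA : associative ladd.
Proof. by move=> x y t; apply: laurentP => n /=; rewrite addrA. Qed.
Lemma laddC : commutative ladd.
Proof. by move=> x y; apply: laurentP => n /=; rewrite addrC. Qed.
Lemma ladd0 : left_id lzero ladd.
Proof. by move=> x; apply: laurentP => n /=; rewrite add0r. Qed.
Lemma laddN : left_inverse lzero lopp ladd.
Proof. by move=> x; apply: laurentP => n /=; rewrite addNr. Qed.

HB.instance Definition _ := GRing.isZmodule.Build laurent laddA laddC ladd0 laddN.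

(* the sum has finitely many nonzero terms, see [lconvE] *)
Definition lconv x y (n : int) : F := \sum_(i \in [set: int]) x i * y (n - i).

Definition lpow (N : int) (K : nat) x := \poly_(i < K) x (N - i%:Z).

Lemma lconvE x y N M (k K : nat) : lbound N x -> lbound M y -> (k < K)%N ->
  lconv x y (N + M - k%:Z) = (lpow N K x * lpow M K y)`_k.
Proof.
move=> xN yM kK; rewrite /lconv.
rewrite (fsbigE [seq N - (val i)%:Z | i <- index_enum 'I_k.+1]) //=.
- under eq_bigl do rewrite in_setT.
  rewrite big_map coefM; apply: eq_bigr => i _; rewrite !coef_poly.
  rewrite (leq_ltn_trans (leq_ord i) kK).
  rewrite (leq_ltn_trans (leq_subr _ _) kK).
  by have ik := ltn_ord i; congr (_ * y _); lia.
- rewrite map_inj_uniq ?index_enum_uniq// => i j ij.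
  by apply/val_inj; move: ij => /=; lia.
- move=> i _; have [iN|Ni] := leP i N; last by rewrite xN// mul0r.
  have [iM|Mi] := leP (N + M - k%:Z - i) M; last by rewrite (yM _ Mi) mulr0.
  move=> /mapP[].
  have h : (absz (N - i)%R < k.+1)%N by lia.
  by exists (Ordinal h); rewrite ?mem_index_enum//=; lia.
Qed.

Lemma lconv0 x y N M n : lbound N x -> lbound M y -> N + M < n ->
  lconv x y n = 0.
Proof.
move=> xN yM NMn; rewrite /lconv fsbig1// => i _.
have [iN|Ni] := leP i N; last by rewrite xN// mul0r.
by rewrite [y _]yM ?mulr0//; lia.
Qed.

Lemma lmul_subproof x y : exists N : int, forall n, N < n -> lconv x y n = 0.
Proof.
have [N xN] := lcoefP x; have [M yM] := lcoefP y.
by exists (N + M) => n; apply: lconv0.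
Qed.
Definition lmul x y := Laurent (lmul_subproof x y).

Lemma lmul_bound x y N M : lbound N x -> lbound M y -> lbound (N + M) (lmul x y).
Proof. by move=> xN yM n; apply: lconv0. Qed.

Lemma lbound_ext x y N : lbound N x -> lbound N y ->
  (forall k : nat, x (N - k%:Z) = y (N - k%:Z)) -> x = y.
Proof.
move=> xN yN xy; apply: laurentP => n; have [nN|Nn] := leP n N.
  by have := xy `|N - n|%N; rewrite (_ : N - _ = n)//; lia.
by rewrite xN// yN.
Qed.

Lemma lpow_mul x y N M K : lbound N x -> lbound M y ->
  lpow (N + M) K (lmul x y) = take_poly K (lpow N K x * lpow M K y).
Proof.
move=> xN yM; apply/polyP => i; rewrite coef_poly coef_take_poly.
by case: ifP => // iK; rewrite /= (lconvE xN yM iK).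
Qed.

Lemma coef_take_mul K (p q : {poly F}) k : (k < K)%N ->
  (take_poly K p * q)`_k = (p * q)`_k.
Proof.
move=> kK; rewrite !coefM; apply: eq_bigr => i _.
by rewrite coef_take_poly (leq_ltn_trans (leq_ord i) kK).
Qed.

Lemma lmulC : commutative lmul.
Proof.
move=> x y; have [N [xN yN]] := lbound2 x y.
apply: (lbound_ext (lmul_bound xN yN) (lmul_bound yN xN)) => k /=.
by rewrite (lconvE xN yN (ltnSn k)) (lconvE yN xN (ltnSn k)) mulrC.
Qed.

Lemma lmulA : associative lmul.
Proof.
move=> x y t; have [N xN] := lcoefP x; have [M yM] := lcoefP y.
have [P tP] := lcoefP t.
have xyB := lmul_bound xN yM; have ytB := lmul_bound yM tP.
have B1 := lmul_bound xN ytB; have B2 := lmul_bound xyB tP.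
rewrite -addrA in B2; apply: (lbound_ext B1 B2) => k /=.
rewrite (lconvE xN ytB (ltnSn k)) addrA (lconvE xyB tP (ltnSn k)).
by rewrite !lpow_mul// coef_take_mul// mulrC coef_take_mul// mulrC mulrA.
Qed.

Lemma lmulDl : left_distributive lmul ladd.
Proof.
move=> x y t; have [N [xN yN]] := lbound2 x y; have [M tM] := lcoefP t.
have xyN : lbound N (ladd x y) by move=> n Nn /=; rewrite xN// yN// addr0.
apply: laurentP => n /=; have [nNM|NMn] := leP n (N + M); last first.
  by rewrite !(@lconv0 _ _ N M)// addr0.
rewrite (_ : n = N + M - (absz (N + M - n)%R)%:Z); last by lia.
set k := absz _; rewrite !(lconvE _ tM (ltnSn k))// -coefD -mulrDl.
suff -> : lpow N k.+1 (ladd x y) = lpow N k.+1 x + lpow N k.+1 y by [].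
by apply/polyP => i; rewrite coefD !coef_poly; case: ifP; rewrite ?addr0.
Qed.

Lemma lone_subproof : exists N : int, forall n, N < n -> (n == 0)%:R = 0 :> F.
Proof. by exists 0 => n n0; rewrite gt_eqF. Qed.
Definition lone := Laurent lone_subproof.

Lemma lmul1 : left_id lone lmul.
Proof.
move=> x; apply: laurentP => n /=.
rewrite /lconv (fsbigE [:: 0 : int])//=.
- by rewrite big_cons big_nil in_setT mul1r subr0 addr0.
- by move=> i _; rewrite inE; case: eqVneq => //= _ _; rewrite mul0r.
Qed.

Lemma lone_neq0 : lone != lzero.
Proof.
apply/eqP => /(congr1 (fun x : laurent => x 0)) /= /eqP.
by rewrite oner_eq0.
Qed.

HB.instance Definition _ :=
  GRing.Zmodule_isComNzRing.Build laurent lmulA lmulC lmul1 lmulDl lone_neq0.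

(* on the zero series the value is a dummy *)
Definition ldeg x : int :=
  xget 0 [set n : int | x n != 0 /\ forall m, n < m -> x m = 0].

Lemma ldegP x : x != 0 -> x (ldeg x) != 0 /\ lbound (ldeg x) x.
Proof.
move=> x0; rewrite /ldeg; case: xgetP => [n _ //|none].
have [N xN] := lcoefP x; exfalso; move/eqP: x0; apply.
suff H k : forall n, N - k%:Z < n -> x n = 0.
  by apply: laurentP => n; apply: (H (absz (N - n)%R).+1); lia.
elim: k => [|k IHk] n nk; first by apply: xN; lia.
have [xn0//|xn_neq0] := eqVneq (x n) 0.
case: (none n); split => // m nm; apply: IHk; lia.
Qed.

Definition linv x : laurent := xget 0 [set y : laurent | y * x = 1].

Lemma linv0 : linv 0 = 0.
Proof.
rewrite /linv; case: xgetP => // y _ /= /esym.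
by rewrite mulr0 => /eqP; rewrite oner_eq0.
Qed.

Section PowerSeriesInverse.
Variable a : nat -> F.
Fixpoint psinv_poly (k : nat) : {poly F} :=
  if k is k'.+1 then
    let p := psinv_poly k' in
    p - ((a 0)^-1 * ((\poly_(i < k'.+2) a i) * p)`_k'.+1) *: 'X^(k'.+1)
  else ((a 0)^-1)%:P.

Lemma psinv_poly_stable k i n : (i <= k)%N ->
  (psinv_poly (k + n))`_i = (psinv_poly k)`_i.
Proof.
move=> ik; elim: n => [|n IHn]; first by rewrite addn0.
rewrite addnS /= coefB coefZ coefXn IHn; case: eqP => [|_]; first by lia.
by rewrite mulr0 subr0.
Qed.

Lemma psinvP : a 0%N != 0 -> forall k,
  \sum_(i < k.+1) a i * (psinv_poly (k - i))`_(k - i) = (k == 0%N)%:R.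
Proof.
move=> a0 k.
transitivity (\sum_(i < k.+1) a i * (psinv_poly k)`_(k - i)).
  apply: eq_bigr => i _; congr (_ * _).
  by have := psinv_poly_stable i (leqnn (k - i)); rewrite subnK ?leq_ord.
case: k => [|k]; first by rewrite big_ord1 /= coefC eqxx mulfV.
set p := psinv_poly k.
pose c := ((\poly_(i < k.+2) a i) * p)`_k.+1.
have cE : c = \sum_(i < k.+2) a i * p`_(k.+1 - i).
  by rewrite /c coefM; apply: eq_bigr => i _; rewrite coef_poly ltn_ord.
rewrite /= -/p -/c.
under eq_bigr do rewrite coefB mulrBr.
rewrite big_split /= -cE big_ord_recl /= subn0 coefZ coefXn eqxx mulr1.
rewrite mulVKf// big1 ?addr0 ?subrr// => i _.
rewrite coefZ coefXn /bump /= add1n subSS.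
by case: eqP => [|_]; [lia|rewrite !mulr0 oppr0].
Qed.
End PowerSeriesInverse.

Lemma lmulV x : x != 0 -> linv x * x = 1.
Proof.
move=> /ldegP[]; set N := ldeg x => xN0 xN.
rewrite /linv; case: xgetP => [//|none]; exfalso.
pose a (i : nat) := x (N - i%:Z).
pose f (n : int) : F :=
  if n <= - N then (psinv_poly a (absz (- N - n)%R))`_(absz (- N - n)%R) else 0.
have fP : forall n, - N < n -> f n = 0.
  by move=> n; rewrite /f ltNge => /negbTE ->.
pose y := Laurent (ex_intro _ (- N) fP).
apply: (none y); rewrite /= mulrC.
have yB : lbound (- N) y by [].
have xyB : lbound 0 (x * y) by rewrite -[0](subrr N); exact: lmul_bound.
have oneB : lbound 0 (1 : laurent) by move=> n n0 /=; rewrite gt_eqF.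
apply: (lbound_ext xyB oneB) => k.
rewrite [LHS](_ : _ = lconv x y (N - N - k%:Z)); last by rewrite subrr.
rewrite (lconvE xN yB (ltnSn k)) coefM [RHS]/=.
transitivity ((k == 0%N)%:R : F); last by congr (_%:R); lia.
have a0 : a 0%N != 0 by rewrite /a subr0.
rewrite -(psinvP a0); apply: eq_bigr => i _; have ik := leq_ord i.
rewrite !coef_poly ltn_ord ltnS leq_subr; congr (_ * _).
rewrite /= /f (_ : _ <= _); last by lia.
by congr ((psinv_poly a _)`_ _); lia.
Qed.

HB.instance Definition _ := GRing.ComNzRing_isField.Build laurent lmulV linv0.

Lemma laurent_poly_subproof (p : {poly F}) : exists N : int, forall n, N < n ->
  (if n is Posz i then p`_i else 0) = 0.
Proof.
exists (size p)%:Z => -[i|//]; rewrite ltz_nat => pi.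
by rewrite nth_default// ltnW.
Qed.
Definition laurent_poly (p : {poly F}) := Laurent (laurent_poly_subproof p).

(* x has no nonzero coefficient of index above `|ldeg x|. *)
Definition poly_part x : {poly F} := \poly_(i < `|ldeg x|.+1) x i%:Z.

Lemma sub_poly_part_ge0 x (k : nat) :
  (x - laurent_poly (poly_part x)) k%:Z = 0.
Proof.
rewrite /= coef_poly; case: ltnP => [_|xk]; first exact: subrr.
rewrite subr0; have [->//|/ldegP[_]] := eqVneq x 0; apply; lia.
Qed.

Lemma sub_poly_part_lt0 x (k : nat) :
  (x - laurent_poly (poly_part x)) (Negz k) = x (Negz k).
Proof. by rewrite /= subr0. Qed.

Definition laurent_irrational x :=
  ~ exists p q : {poly F}, q != 0 /\ x = laurent_poly p / laurent_poly q.

(* x_0 = x - [x] and x_(k+1) = 1/x_k - [1/x_k]. *)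
Fixpoint cf_tail x (k : nat) : laurent :=
  if k is k'.+1 then
    let y := (cf_tail x k')^-1 in y - laurent_poly (poly_part y)
  else x - laurent_poly (poly_part x).

Definition cf_quotient x (k : nat) : {poly F} :=
  if k is k'.+1 then poly_part (cf_tail x k')^-1 else poly_part x.

(* the pair (Q_(k-1), Q_k) *)
Fixpoint cf_den_pair x (k : nat) : {poly F} * {poly F} :=
  if k is k'.+1 then
    let: (Qp, Q) := cf_den_pair x k' in (Q, cf_quotient x k * Q + Qp)
  else (0, 1).

Definition cf_den x k := (cf_den_pair x k).2.

End LaurentField.

Section Hausdorff.
Context {R : realType} {T : metricType R}.
Implicit Types (A U : set T) (s delta : R).
Local Open Scope ereal_scope.

(* the supremum over the empty set is -oo, hence the case in [diameter_pow] *)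
Definition diameter U : \bar R :=
  ereal_sup [set (mdist p.1 p.2)%:E | p in U `*` U].

Definition diameter_pow s U : \bar R :=
  if U == set0 then 0 else diameter U `^ s.

Definition hausdorff_premeasure s delta A : \bar R :=
  ereal_inf [set \sum_(0 <= i <oo) diameter_pow s (U i) | U in
    [set U : (set T)^nat | A `<=` \bigcup_i U i /\
                           forall i, diameter (U i) <= delta%:E]].

Definition hausdorff_measure s A : \bar R :=
  ereal_sup [set hausdorff_premeasure s delta A | delta in [set d : R | (0 < d)%R]].

Definition hausdorff_dim A : \bar R :=
  ereal_inf [set s%:E | s in [set s : R | (0 <= s)%R /\ hausdorff_measure s A = 0]].

End Hausdorff.

(* The index R, the codomain of the distance, is what lets the metric structure
   below be found by unification. *)
Definition laurent_space (R : realType) (F : finFieldType) : Type := laurent F.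

Section Norm.
Variables (R : realType) (F : finFieldType).

Definition lnorm (x : laurent F) : R :=
  if x == 0 then 0 else #|F|%:R ^ ldeg x.

Lemma lnorm0 : lnorm 0 = 0.
Proof. by rewrite /lnorm eqxx. Qed.

Lemma card_gt1R : 1 < #|F|%:R :> R.
Proof. by rewrite ltr1n card_finNzRing_gt1. Qed.

Lemma lnorm_ge0 x : 0 <= lnorm x.
Proof. by rewrite /lnorm; case: ifP => // _; rewrite exprz_ge0. Qed.

Lemma lnorm_eq0 x : lnorm x = 0 -> x = 0.
Proof.
rewrite /lnorm; case: eqP => // _ /eqP.
by rewrite expfz_eq0 (gt_eqF (lt_trans ltr01 card_gt1R)) andbF.
Qed.

Lemma lnorm_le x N : lbound N x -> lnorm x <= #|F|%:R ^ N.
Proof.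
move=> xN; rewrite /lnorm; case: eqVneq => [_|/ldegP[xd _]].
  by rewrite exprz_ge0.
apply: ler_weXz2l; first exact: ltW card_gt1R.
by rewrite leNgt; apply: contra xd => /xN ->.
Qed.

Lemma lnormN x : lnorm (- x) = lnorm x.
Proof.
rewrite /lnorm oppr_eq0; case: ifP => // _; congr (_ ^ _).
rewrite /ldeg; congr (xget _ _); apply/funext => n /=.
rewrite oppr_eq0; apply/propext.
split=> -[xn xm]; split=> // m /xm; last by move=> ->; rewrite oppr0.
by move=> /eqP; rewrite oppr_eq0 => /eqP.
Qed.

Lemma lnormD x y : lnorm (x + y) <= Num.max (lnorm x) (lnorm y).
Proof.
have [->|x0] := eqVneq x 0; first by rewrite add0r le_max lexx orbT.
have [->|y0] := eqVneq y 0; first by rewrite addr0 le_max lexx.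
have [_ xB] := ldegP x0; have [_ yB] := ldegP y0.
have H N : lbound N x -> lbound N y -> lnorm (x + y) <= #|F|%:R ^ N.
  by move=> xN yN; apply: lnorm_le => n Nn /=; rewrite xN// yN// addr0.
rewrite le_max /lnorm (negbTE x0) (negbTE y0) -/(lnorm (x + y)).
have [xy|yx] := leP (ldeg x) (ldeg y).
  by rewrite (H (ldeg y)) ?orbT//; apply: lboundW xB.
by rewrite (H (ldeg x))//; apply: lboundW yB; exact: ltW.
Qed.

HB.instance Definition _ := GRing.Field.on (laurent_space R F).

Let dist (x y : laurent_space R F) : R := lnorm (x - y).

Let distxx x : dist x x = 0.
Proof. by rewrite /dist subrr lnorm0. Qed.

Let dist_positivity x y : dist x y = 0 -> x = y.
Proof. by move=> /lnorm_eq0/eqP; rewrite subr_eq0 => /eqP. Qed.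

Let dist_sym x y : dist x y = dist y x.
Proof. by rewrite /dist -lnormN opprB. Qed.

Let dist_triangle y x t : dist x t <= dist x y + dist y t.
Proof.
rewrite /dist -(subrKA y); apply: le_trans (lnormD _ _) _.
by rewrite ge_max lerDl lerDr !lnorm_ge0.
Qed.

HB.instance Definition _ := isMetric.Build R (laurent_space R F)
  distxx dist_positivity dist_sym dist_triangle.

Lemma lnorm_sub_poly_part x p :
  lnorm (x - laurent_poly (poly_part x)) <= lnorm (x - laurent_poly p).
Proof.
set y := x - laurent_poly p.
have yx k : y (Negz k) = x (Negz k) by rewrite /= subr0.
have [y0|y0] := eqVneq y 0; rewrite [leRHS]/lnorm.
  rewrite y0 eqxx (_ : _ - _ = 0) ?lnorm0//; apply: laurentP => -[k|k].
    exact: sub_poly_part_ge0.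
  by rewrite sub_poly_part_lt0 -yx y0.
rewrite (negbTE y0); apply: lnorm_le => -[k|k] yk.
  exact: sub_poly_part_ge0.
by rewrite sub_poly_part_lt0 -yx (proj2 (ldegP y0)).
Qed.

Definition poly_dist (x : laurent F) : R :=
  inf [set lnorm (x - laurent_poly p) | p in [set: {poly F}]].

(* [poly_dist x] is a minimum. *)
Lemma poly_dist_attained x :
  exists p : {poly F}, poly_dist x = lnorm (x - laurent_poly p).
Proof.
exists (poly_part x); apply: le_anti; apply/andP; split.
  apply: ge_inf; last by exists (poly_part x).
  by exists 0 => _ [p _ <-]; exact: lnorm_ge0.
apply: lb_le_inf; first by exists (lnorm (x - laurent_poly 0)), 0.
by move=> _ [p _ <-]; exact: lnorm_sub_poly_part.
Qed.

(* lower limit of f(Q) as the norm of Q tends to infinity *)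
Definition liminf_poly (f : {poly F} -> \bar R) : \bar R :=
  ereal_sup [set ereal_inf [set f Q | Q in [set Q | M < lnorm (laurent_poly Q)]]
            | M in [set: R]].

Definition Bad (eps : R) (alpha : laurent F) : set (laurent_space R F) :=
  [set theta | lnorm theta < 1 /\
    (eps%:E <= liminf_poly (fun Q =>
      (lnorm (laurent_poly Q) *
       poly_dist (laurent_poly Q * alpha - theta))%:E))%E].

End Norm.

(* Main.v *)
Require Import Defs.
From HB Require Import structures.
From mathcomp Require Import all_boot all_order all_algebra.
From mathcomp Require Import zify ring lra.
From mathcomp Require Import all_classical all_reals all_analysis.
Set Implicit Arguments.
Unset Strict Implicit.
Unset Printing Implicit Defensive.
Import Order.TTheory GRing.Theory Num.Theory.
Import numFieldNormedType.Exports.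
Local Open Scope classical_set_scope.
Local Open Scope ring_scope.

(* For theta in the unit ball the residue of Q_k theta involves only the first
   d_k + 1 digits of theta, where d_k = deg Q_k, and digit number d_k + 1 enters
   with a nonzero coefficient.  If all these residues are nonzero then theta is
   badly approximable: pair Q_k with Q alpha - theta for the right k.  This
   forbids a single value of one digit at each position d_k + 1, and when
   d_k / k tends to infinity such a sparse restriction leaves a set of dimension
   1, by a mass distribution argument.  Conversely, every prefix of d_(k+1) - 1
   digits is a prefix of the fractional part of Q alpha for some Q with
   d_k <= deg Q < d_(k+1), so theta in Bad^eps must avoid the next w digits of
   that expansion, with w depending on eps only.  If d_k <= L k infinitely
   often, then counting cylinders of level d_k yields a dimension less than 1. *)

(** * Digits and continued fractions *)

Section Laurent.
Variable F : fieldType.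
Implicit Types (x y : laurent F) (p q : {poly F}).

(* [digit x n] is the coefficient of z^-(n+1). *)
Definition digit x (n : nat) : F := x (Negz n).

Lemma digitD x y n : digit (x + y) n = digit x n + digit y n.
Proof. by []. Qed.

Lemma digitB x y n : digit (x - y) n = digit x n - digit y n.
Proof. by []. Qed.

Lemma digit_poly p n : digit (laurent_poly p) n = 0.
Proof. by []. Qed.

Lemma laurent_polyD p q : laurent_poly (p + q) = laurent_poly p + laurent_poly q.
Proof. by apply: laurentP => -[n|n] /=; rewrite ?coefD ?addr0. Qed.

Lemma laurent_poly0 : laurent_poly 0 = 0 :> laurent F.
Proof. by apply: laurentP => -[n|n] /=; rewrite ?coef0. Qed.

Lemma laurent_poly1 : laurent_poly 1 = 1 :> laurent F.
Proof. by apply: laurentP => -[n|n] /=; rewrite ?coef1. Qed.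

Lemma laurent_mulE x y (n : int) : (x * y) n = lconv x y n.
Proof. by []. Qed.

Lemma lconv_polyl p x n :
  lconv (laurent_poly p) x n = \sum_(j < size p) p`_j * x (n - j%:Z).
Proof.
rewrite /lconv (fsbigE [seq (val i)%:Z | i <- index_enum 'I_(size p)]) //=.
- by under eq_bigl do rewrite in_setT; rewrite big_map.
- rewrite map_inj_uniq ?index_enum_uniq// => i j ij.
  by apply/val_inj; case: ij.
- move=> [i|i] _; last by rewrite mul0r.
  have [ip|pi] := ltnP i (size p); last by rewrite nth_default// mul0r.
  by move=> /mapP[]; exists (Ordinal ip); rewrite ?mem_index_enum.
Qed.

Lemma laurent_polyM p q : laurent_poly (p * q) = laurent_poly p * laurent_poly q.
Proof.
apply: laurentP => n; rewrite laurent_mulE lconv_polyl; case: n => n /=; last first.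
  rewrite big1// => i _; rewrite (_ : Negz n - i%:Z = Negz (n + i)) ?mulr0//; lia.
rewrite coefM (big_ord_widen_cond (maxn n.+1 (size p)) xpredT
  (fun i => p`_i * q`_(n - i)))
  ?leq_maxl//.
rewrite [RHS](big_ord_widen_cond (maxn n.+1 (size p)) xpredT
  (fun i => p`_i * laurent_poly q (n%:Z - i%:Z))) ?leq_maxr//.
rewrite big_mkcond [RHS]big_mkcond; apply: eq_bigr => i _ /=.
have [ni|ni] := ltnP i n.+1; have [pi|pi] := ltnP i (size p) => //.
- by rewrite (_ : n%:Z - i%:Z = (n - i)%N)//; lia.
- by rewrite nth_default ?mul0r.
- by rewrite (_ : n%:Z - i%:Z = Negz (i - n.+1)%N) ?mulr0//; lia.
Qed.

Lemma digit_polyM p x n :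
  digit (laurent_poly p * x) n = \sum_(j < size p) p`_j * digit x (n + j).
Proof.
rewrite /digit laurent_mulE lconv_polyl; apply: eq_bigr => j _.
by congr (_ * x _); lia.
Qed.

(** A relation that never holds of the zero series, so the dummy value of [ldeg] at 0 cannot
    interfere with degree computations. *)
Definition exact_deg x (n : int) := x n != 0 /\ Defs.lbound n x.

Lemma exact_deg_inj x n m : exact_deg x n -> exact_deg x m -> n = m.
Proof.
move=> [xn nx] [xm mx]; apply: le_anti; rewrite !leNgt; apply/andP; split.
  by apply: contra xn => h; rewrite mx.
by apply: contra xm => h; rewrite nx.
Qed.

Lemma exact_deg_ldeg x : x != 0 -> exact_deg x (ldeg x).
Proof. exact: ldegP. Qed.

Lemma exact_deg_neq0 x n : exact_deg x n -> x != 0.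
Proof. by move=> [xn _]; apply: contraNneq xn => ->. Qed.

Lemma exact_degM x y n m : exact_deg x n -> exact_deg y m ->
  exact_deg (x * y) (n + m).
Proof.
move=> [xn nx] [ym my]; split; last exact: lmul_bound.
rewrite laurent_mulE -[X in lconv _ _ X]subr0 (lconvE nx my (ltnSn 0)).
by rewrite coefM big_ord1 !coef_poly !subr0 mulf_neq0.
Qed.

Lemma exact_degN x n : exact_deg x n -> exact_deg (- x) n.
Proof.
by move=> [xn nx]; split=> [|m nm] /=; [rewrite oppr_eq0 | rewrite nx ?oppr0].
Qed.

Lemma exact_deg1 : exact_deg 1 0.
Proof. by split=> [|n n0] /=; rewrite ?oner_eq0 // gt_eqF. Qed.

Lemma exact_degV x n : exact_deg x n -> exact_deg x^-1 (- n).
Proof.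
move=> xn; have x0 := exact_deg_neq0 xn.
have xV0 : x^-1 != 0 by rewrite invr_eq0.
have := exact_degM xn (exact_deg_ldeg xV0); rewrite divff//.
move=> /exact_deg_inj /(_ exact_deg1) /eqP; rewrite addr_eq0 => /eqP ->.
by rewrite opprK; exact: exact_deg_ldeg.
Qed.

Lemma exact_deg_poly p : p != 0 -> exact_deg (laurent_poly p) (size p).-1.
Proof.
move=> p0; split=> [|[m|//]] /=; first by rewrite -/(lead_coef p) lead_coef_eq0.
rewrite ltz_nat => pm; rewrite nth_default//; lia.
Qed.

Lemma exact_deg_size x p (n : nat) : exact_deg x n ->
  (forall k : nat, x k%:Z = p`_k) -> size p = n.+1.
Proof.
move=> [xn nx] xp; apply/eqP; rewrite eqn_leq; apply/andP; split.
  by apply/leq_sizeP => j nj; rewrite -xp nx.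
by rewrite ltnNge; apply: contra xn => pn; rewrite xp nth_default.
Qed.

Definition fracl x := x - laurent_poly (poly_part x).

Lemma fracl_lbound x : Defs.lbound (-1) (fracl x).
Proof. by case=> [n _|//]; exact: sub_poly_part_ge0. Qed.

Lemma fracl_digit x : digit (fracl x) =1 digit x.
Proof. by move=> n; rewrite /digit sub_poly_part_lt0. Qed.

Lemma poly_partE x (n : nat) : (poly_part x)`_n = x n%:Z.
Proof.
have /eqP := sub_poly_part_ge0 x n.
by rewrite [_%R n%:Z]/= subr_eq0 => /eqP ->.
Qed.

End Laurent.

Section ContinuedFraction.
Variables (F : fieldType) (alpha : laurent F).
Hypothesis alpha_irr : laurent_irrational alpha.
Local Notation Q := (cf_den alpha).
Local Notation X := (cf_tail alpha).

Definition cf_deg k := (size (Q k)).-1.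

Lemma cf_tail_lbound k : Defs.lbound (-1) (X k).
Proof. by case: k => [|k]; exact: fracl_lbound. Qed.

Definition is_lpoly (x : laurent F) := exists p, x = laurent_poly p.

(* Up to sign, [tail_prod k.+1] is the remainder Q_k alpha - P_k. *)
Definition tail_prod k : laurent F := \prod_(i < k) - X i.

Lemma tail_prodS k : tail_prod k.+1 = tail_prod k * - X k.
Proof. by rewrite /tail_prod big_ord_recr. Qed.

(** Write T_k for [tail_prod k]. Since X_(k+1) = 1/X_k - A_(k+1), one has T_(k+2) = A_(k+1) T_(k+1)
    + T_k, the recursion of the denominators, so Q_k alpha + T_(k+1) remains a polynomial. As deg
    A_(k+1) = - deg X_k, the degrees of T_k and Q_k stay opposite. *)
Lemma cf_invariant k : let: (Qp, Qk) := cf_den_pair alpha k in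
  [/\ (size Qp < size Qk)%N,
      is_lpoly (laurent_poly Qp * alpha + tail_prod k),
      is_lpoly (laurent_poly Qk * alpha + tail_prod k.+1) &
      exact_deg (tail_prod k) (- (size Qk).-1%:Z)].
Proof.
elim: k => [|k] /=.
  split; first by rewrite size_poly0 size_poly1.
  - by exists 1; rewrite /tail_prod big_ord0 laurent_poly0 mul0r add0r laurent_poly1.
  - exists (poly_part alpha); rewrite /tail_prod big_ord1 /= laurent_poly1 mul1r.
    by rewrite opprB addrCA subrr addr0.
  - by rewrite /tail_prod big_ord0 size_poly1 oppr0; exact: exact_deg1.
case: (cf_den_pair alpha k) => Qp Qk [QpQ [pp ppE] [p pE] Ek].
have Q0 : Qk != 0 by rewrite -size_poly_gt0; exact: leq_ltn_trans QpQ.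
(* A vanishing tail would make Q_k alpha a polynomial, hence alpha rational. *)
have Xk0 : X k != 0.
  apply/eqP => Xk0; apply: alpha_irr; exists p, Qk; split=> //.
  rewrite -pE tail_prodS Xk0 oppr0 mulr0 addr0 mulrC mulKf//.
  exact: exact_deg_neq0 (exact_deg_poly Q0).
have [a Xka] : exists a : nat, exact_deg (X k) (- a.+1%:Z).
  exists (absz (ldeg (X k) + 1)%R).
  suff <- : ldeg (X k) = - (absz (ldeg (X k) + 1)%R).+1%:Z by exact: exact_deg_ldeg.
  suff : ldeg (X k) <= -1 by lia.
  rewrite leNgt; apply: contra (proj1 (exact_deg_ldeg Xk0)) => h.
  by rewrite cf_tail_lbound.
set A := poly_part (X k)^-1.
have sA : size A = a.+2.
  apply: (exact_deg_size (exact_degV Xka)) => n /=.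
  by rewrite -poly_partE.
have A0 : A != 0 by rewrite -size_poly_gt0 sA.
have sAQ : size (A * Qk) = (a.+1 + size Qk)%N by rewrite size_mul// sA addSn.
have sQ' : size (A * Qk + Qp) = (a.+1 + size Qk)%N.
  by rewrite size_polyDl sAQ// addSn ltnS ltnW// ltn_addl.
split.
- by rewrite sQ' addSn ltnS leq_addl.
- by exists p.
- exists (A * p + pp).
  rewrite !laurent_polyD !laurent_polyM -pE -ppE !tail_prodS /= -/A.
  (* [ring] treats x and y as independent; the relation y x = 1 enters only after the first
     identity. *)
  have e := mulVf Xk0; set x := X k in e *; set y := x^-1 in e *.
  transitivity (laurent_poly A * (laurent_poly Qk * alpha - tail_prod k * x)
    + (laurent_poly Qp * alpha + tail_prod k * (y * x))); last by rewrite e; ring.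
  by ring.
- rewrite tail_prodS sQ' (_ : - _ = - (size Qk).-1%:Z + - a.+1%:Z); last first.
    by move: Q0; rewrite -size_poly_gt0; lia.
  exact: exact_degM (exact_degN _).
Qed.

Lemma cf_den_pairE k : cf_den_pair alpha k.+1 = (Q k, Q k.+1).
Proof. by rewrite /cf_den /=; case: (cf_den_pair alpha k). Qed.

Lemma cf_den_neq0 k : Q k != 0.
Proof.
have := cf_invariant k; rewrite /cf_den.
case: (cf_den_pair alpha k) => Qp Qk [+ _ _ _] /=.
by rewrite -size_poly_gt0; exact: leq_ltn_trans.
Qed.

Lemma size_cf_den k : size (Q k) = (cf_deg k).+1.
Proof. by rewrite /cf_deg prednK// size_poly_gt0 cf_den_neq0. Qed.

Lemma cf_deg0 : cf_deg 0 = 0%N.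
Proof. by rewrite /cf_deg size_poly1. Qed.

Lemma cf_deg_lt k : (cf_deg k < cf_deg k.+1)%N.
Proof.
have := cf_invariant k.+1; rewrite cf_den_pairE => -[+ _ _ _].
by rewrite !size_cf_den.
Qed.

(** Up to a polynomial, Q_k alpha is -T_(k+1), of degree exactly -d_(k+1); digit n is the
    coefficient of z^-(n+1), hence the predecessor. *)
Lemma cf_rem_digits k :
  (forall j, (j < (cf_deg k.+1).-1)%N -> digit (laurent_poly (Q k) * alpha) j = 0)
  /\ digit (laurent_poly (Q k) * alpha) (cf_deg k.+1).-1 != 0.
Proof.
have := cf_invariant k.+1; rewrite cf_den_pairE => -[_ [p pE] _ []].
rewrite -/(cf_deg k.+1); have d0 := leq_ltn_trans (leq0n _) (cf_deg_lt k).
move=> En nE.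
have dE j : digit (laurent_poly (Q k) * alpha) j = - digit (tail_prod k.+1) j.
  apply/eqP; rewrite -addr_eq0 -digitD pE; exact/eqP/digit_poly.
split=> [j jd|]; rewrite dE ?oppr_eq0.
  by rewrite /digit nE ?oppr0//; lia.
by rewrite /digit (_ : Negz _ = - (cf_deg k.+1)%:Z)//; lia.
Qed.

Lemma leq_cf_deg k : (k <= cf_deg k)%N.
Proof. by elim: k => // k IHk; exact: leq_ltn_trans (cf_deg_lt k). Qed.

End ContinuedFraction.

(** * Hausdorff measures in the space of Laurent series *)

Lemma powR_geo_small (R : realType) (b s e : R) : 1 < b -> 0 < s -> 0 < e ->
  exists n0, forall n, (n0 <= n)%N -> (b ^- n) `^ s <= e.
Proof.
move=> b1 s0 e0; have b0 : 0 < b by apply: lt_trans b1.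
have z0 : 0 <= b^-1 `^ s by exact: powR_ge0.
have : (fun n => (b^-1 `^ s) ^+ n) @ \oo --> (0 : R).
  apply: cvg_expr; rewrite ger0_norm// -(powR_inv1 (ltW b0)) -powRrM mulN1r.
  rewrite powRN invf_lt1 ?powR_gt0//.
  have : 1 `^ s < b `^ s by rewrite gt0_ltr_powR ?nnegrE ?ler01 ?(ltW b0).
  by rewrite powR1.
move=> /cvgr0_norm_lt /(_ _ e0) [n0 _ nP]; exists n0 => n /nP /=.
rewrite ger0_norm ?exprn_ge0// => /ltW h; apply: le_trans _ h.
have bV0 : 0 <= b^-1 by rewrite invr_ge0 ltW.
by rewrite -exprVn -(powR_mulrn n z0) -(powR_mulrn n bV0) -!powRrM mulrC.
Qed.

(** With s = 1 - 1/(n+1) the claim is the (n+1)-th root of B rho^(n+1) < 1, which holds for large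
    n. *)
Lemma exists_exponent_lt1 (R : realType) (B rho : R) : 1 <= B -> 0 <= rho < 1 ->
  exists s : R, [/\ 0 <= s, s < 1 & B `^ (1 - s) * rho < 1].
Proof.
move=> B1 /andP[rho0 rho1]; have B0 : 0 < B by apply: lt_le_trans B1.
have [n Bn] : exists n, B * rho ^+ n.+1 < 1.
  have : (fun n => B * rho ^+ n) @ \oo --> (0 : R).
    by rewrite -(mulr0 B); apply: cvgMr; apply: cvg_expr; rewrite ger0_norm.
  move=> /cvgr0_norm_lt /(_ _ ltr01) [n _ /(_ n.+1 (leqnSn n)) /=].
  by rewrite ger0_norm ?mulr_ge0 ?exprn_ge0 ?(ltW B0)//; exists n.
have n0 : 0 < n.+1%:R :> R by [].
exists (1 - n.+1%:R^-1); split.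
- by rewrite subr_ge0 invf_le1// ler1n.
- by rewrite ltrBlDr ltrDl invr_gt0.
- rewrite opprB addrCA subrr addr0.
  have -> : B `^ n.+1%:R^-1 * rho = (B * rho ^+ n.+1) `^ n.+1%:R^-1.
    rewrite powRM ?exprn_ge0 ?(ltW B0)//; congr (_ * _).
    by rewrite -powR_mulrn// -powRrM divff ?powRr1// gt_eqF.
  have h : 1 `^ n.+1%:R^-1 = 1 :> R by rewrite powR1.
  rewrite -[ltRHS]h gt0_ltr_powR ?nnegrE ?invr_gt0//.
  by rewrite mulr_ge0 ?exprn_ge0 ?(ltW B0).
Qed.

Section HausdorffGeneral.
Context {R : realType} {T : metricType R}.
Implicit Types (A U : set T) (s delta : R).
Local Open Scope ereal_scope.

Lemma diameter_pow_ge0 s U : 0 <= diameter_pow s U.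
Proof. by rewrite /diameter_pow; case: ifP => // _; exact: poweR_ge0. Qed.

Lemma hausdorff_premeasure_ge0 s delta A : 0 <= hausdorff_premeasure s delta A.
Proof.
apply: le_ereal_inf_tmp => _ [U _ <-]; apply: nneseries_ge0 => i _ _.
exact: diameter_pow_ge0.
Qed.

Lemma hausdorff_premeasure_subset s delta A B : A `<=` B ->
  hausdorff_premeasure s delta A <= hausdorff_premeasure s delta B.
Proof.
move=> AB; apply: ereal_inf_le_tmp => _ [U [BU Ud] <-].
by exists U => //; split=> //; exact: subset_trans BU.
Qed.

(* The premeasure is the outer measure generated on arbitrary sets by the
   gauge that is +oo on the sets of diameter larger than delta. *)
Let gauge s delta (U : set T) : \bar R :=
  if diameter U <= delta%:E then diameter_pow s U else +oo.

Let gauge_ge0 s delta U : 0 <= gauge s delta U.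
Proof. by rewrite /gauge; case: ifP => // _; exact: diameter_pow_ge0. Qed.

Let premeasure_subadditive s delta (A : (set T)^nat) :
  hausdorff_premeasure s delta (\bigcup_m A m) <=
  \sum_(m <oo) hausdorff_premeasure s delta (A m).
Proof.
(* The outer measure lives on a pointed type. If T has no point, all its sets are equal and the
   first term of the series suffices. *)
have [[t _]|noT] := pselect (exists t : T, True); last first.
  rewrite (_ : \bigcup_m A m = A 0%N); last first.
    by apply/seteqP; split=> t; case: noT; exists t.
  apply: le_trans (nneseries_lim_ge 1 _) => [|i _ _].
    by rewrite big_nat1.
  exact: hausdorff_premeasure_ge0.
pose PT : pointedType := HB.pack_for pointedType T (isPointed.Build T t).
pose TT := g_sigma_algebraType [set: set PT].
have premeasureE B :
  hausdorff_premeasure s delta B = mu_ext (gauge s delta : set TT -> \bar R) B.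
  apply/eqP; rewrite eq_le; apply/andP; split.
    apply: le_ereal_inf_tmp => _ [U [_ AU] <-].
    have [Ud|] := pselect (forall i, diameter (U i) <= delta%:E).
      apply: ereal_inf_lbound; exists (U : (set T)^nat) => //.
      by apply: eq_eseriesr => i _; rewrite /gauge Ud.
    (* A cover with one set too large has an infinite gauge sum and does not affect the infimum. *)
    move=> /existsNP[i /negP/negbTE Ui].
    rewrite (eseries_pinfty (k := i)) ?leey//; last by rewrite /gauge Ui.
    by move=> n _; rewrite -ltNye (lt_le_trans _ (gauge_ge0 _ _ _)).
  apply: le_ereal_inf_tmp => _ [U [AU Ud] <-].
  apply: ereal_inf_lbound; exists (U : (set TT)^nat) => //.
    by split=> // i; exact: sub_gen_smallest.
by apply: eq_eseriesr => i _; rewrite /gauge Ud.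
rewrite premeasureE; under eq_eseriesr do rewrite premeasureE.
exact: (mu_ext_sigma_subadditive
  (mu := gauge s delta : set TT -> \bar R) (gauge_ge0 s delta)).
Qed.

Lemma hausdorff_measure_bigcup_null s (A : (set T)^nat) :
  (forall m, hausdorff_measure s (A m) = 0) ->
  hausdorff_measure s (\bigcup_m A m) = 0.
Proof.
move=> A0; apply/eqP; rewrite eq_le; apply/andP; split; last first.
  apply: le_trans (hausdorff_premeasure_ge0 s 1 (\bigcup_m A m)) _.
  by apply: ereal_sup_ubound; exists 1%R => //=.
apply: ge_ereal_sup => _ [delta d0 <-].
apply: le_trans (premeasure_subadditive s delta A) _.
rewrite eseries0// => i _ _.
apply/eqP; rewrite eq_le hausdorff_premeasure_ge0 andbT -(A0 i).
by apply: ereal_sup_ubound; exists delta.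
Qed.

Lemma hausdorff_measure_subset s A B : A `<=` B ->
  hausdorff_measure s A <= hausdorff_measure s B.
Proof.
move=> AB; apply: ge_ereal_sup => _ [delta d0 <-].
apply: le_trans (hausdorff_premeasure_subset s delta AB) _.
by apply: ereal_sup_ubound; exists delta.
Qed.

Lemma hausdorff_measure_ge0 s A : 0 <= hausdorff_measure s A.
Proof.
apply: le_trans (hausdorff_premeasure_ge0 s 1 A) _.
by apply: ereal_sup_ubound; exists 1%R => //=.
Qed.

End HausdorffGeneral.

(** * Cylinders, and upper bounds for Hausdorff measures by counting them *)

Section Digits.
Variables (R : realType) (F : finFieldType).
Local Notation q := (#|F|%:R : R).
Implicit Types (x y : laurent F) (u v : nat -> F).

Lemma card_gt0R : 0 < q. Proof. exact: lt_trans ltr01 (card_gt1R R F). Qed.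
Local Notation q_gt0 := card_gt0R.
Let q_gt1 : 1 < q. Proof. exact: card_gt1R. Qed.
Hint Resolve card_gt0R q_gt1 : core.

Lemma lnorm_ge x m : x m != 0 -> q ^ m <= lnorm R x.
Proof.
move=> xm; have x0 : x != 0 by apply: contraNneq xm => ->.
rewrite /lnorm (negbTE x0); apply: ler_weXz2l; first exact: ltW.
by rewrite leNgt; apply: contra xm => h; rewrite (proj2 (ldegP x0)).
Qed.

Lemma lnorm_lt1 x : (lnorm R x < 1) <-> Defs.lbound (-1) x.
Proof.
split=> [x1 m m0|xB].
  apply/eqP/negPn/negP => /lnorm_ge; apply/negP; rewrite -ltNge.
  apply: lt_le_trans x1 _; rewrite -[1](expr0z q); apply: ler_weXz2l; first exact: ltW.
  by lia.
apply: le_lt_trans (lnorm_le R xB) _.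
by rewrite -[ltRHS](expr0z q) ltr_eXz2l.
Qed.

Lemma lnorm_le_digits x n : Defs.lbound (-1) x ->
  (forall i, (i < n)%N -> digit x i = 0) -> lnorm R x <= q ^- n.+1.
Proof.
move=> xB xn; apply: (@lnorm_le _ _ _ (Negz n)) => -[m|m] nm; first exact: xB.
by apply: xn; lia.
Qed.

Lemma lnorm_ge_digit x n : digit x n != 0 -> q ^- n.+1 <= lnorm R x.
Proof. exact: lnorm_ge. Qed.

Lemma laurent_of_digits_subproof u :
  exists N : int, forall n, N < n -> (if n is Negz i then u i else 0) = 0.
Proof. by exists (-1) => -[]. Qed.
Definition laurent_of_digits u := Laurent (laurent_of_digits_subproof u).

Definition agree n u v : bool := [forall i : 'I_n, u i == v i].

Lemma agreeP n u v : reflect (forall i, (i < n)%N -> u i = v i) (agree n u v).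
Proof.
apply: (iffP forallP) => [uv i ni|uv i]; first exact: eqP (uv (Ordinal ni)).
by rewrite uv.
Qed.

Lemma agreeC n u v : agree n u v = agree n v u.
Proof. by apply: eq_forallb => i; rewrite eq_sym. Qed.

Lemma agree_trans n u v w : agree n u v -> agree n v w -> agree n u w.
Proof. by move=> /agreeP uv /agreeP vw; apply/agreeP => i ni; rewrite uv ?vw. Qed.

(** The prefix is carried by an infinite sequence of which only the first n terms count, so that no
    type depends on n. *)
Definition cylinder n u : set (laurent_space R F) :=
  [set x | lnorm R x < 1 /\ agree n (digit x) u].

Lemma diameter_cylinder n u : (diameter (cylinder n u) <= (q ^- n)%:E)%E.
Proof.
apply: ge_ereal_sup => _ [[x y] [/= [x1 xu] [y1 yu]] <-].
rewrite lee_fin; apply: (@le_trans _ _ (q ^- n.+1)).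
  apply: lnorm_le_digits => [m m1|i ni] /=.
    by rewrite ((lnorm_lt1 x).1 x1 m m1) ((lnorm_lt1 y).1 y1 m m1) subr0.
  by apply/eqP; rewrite subr_eq0 -!/(digit _ _) (agreeP _ _ _ xu)// (agreeP _ _ _ yu).
by rewrite lef_pV2 ?posrE ?exprn_gt0// ler_weXn2l// ltW.
Qed.

Lemma diameter_ge0 (U : set (laurent_space R F)) : U !=set0 -> (0 <= diameter U)%E.
Proof.
move=> [x Ux]; apply: ereal_sup_ubound; exists (x, x) => //=.
by rewrite mdistxx.
Qed.

Lemma diameter_pow_cylinder s n u : 0 <= s ->
  (diameter_pow s (cylinder n u) <= ((q ^- n) `^ s)%:E)%E.
Proof.
move=> s0; rewrite /diameter_pow; case: ifPn => [_|/set0P U0].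
  by rewrite lee_fin powR_ge0.
rewrite -poweR_EFin; apply: gt0_ler_poweR => //.
- by rewrite in_itv /= leey diameter_ge0.
- by rewrite in_itv /= leey lee_fin invr_ge0 exprn_ge0.
- exact: diameter_cylinder.
Qed.

(** If n is the first position where two points of U in the unit ball differ, these points all lie
    in one cylinder of level n and U has diameter at least q^-(n+1); the lost factor q^s' is at most
    q because s' <= 1. The error e serves the case of at most one point, where the diameter power
    may vanish. *)
Lemma cylinder_of_diameter (U : set (laurent_space R F)) (s s' e : R) :
  0 <= s <= s' -> 0 < s' <= 1 -> 0 < e ->
  exists l v, U `&` [set x | lnorm R x < 1] `<=` cylinder l v /\
    (((q ^- l) `^ s')%:E <= q%:E * diameter_pow s U + e%:E)%E.
Proof.
move=> /andP[s0 ss'] /andP[s'0 s'1] e0.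
set V := U `&` _.
have [|same] := pselect (exists n, `[< exists x y : laurent_space R F,
    [/\ V x, V y & digit x n != digit y n] >]).
  move=> /ex_minnP[n /asboolP[x [y [Vx Vy xyn]]] nmin].
  exists n, (digit x); split.
    move=> z Vz; split; first exact: Vz.2.
    apply/agreeP => i; apply: contraTeq => zxi; rewrite -leqNgt; apply: nmin.
    by apply/asboolP; exists z, x.
  apply: (@le_trans _ _ (q%:E * diameter_pow s U)%E); last by rewrite leeDl// lee_fin ltW.
  apply: (@le_trans _ _ (q%:E * ((q ^- n.+1) `^ s')%:E)%E).
    rewrite -EFinM lee_fin exprS invfM powRM ?invr_ge0 ?exprn_ge0 ?(ltW q_gt0)//.
    rewrite mulrA -[leLHS]mul1r ler_wpM2r ?powR_ge0//.
    rewrite -[q in q * _](powRr1 (ltW q_gt0)) -(powR_inv1 (ltW q_gt0)) -powRrM mulN1r.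
    rewrite -powRD ?(gt_eqF q_gt0) ?implybT// -[leLHS](powRr0 q).
    by rewrite ler_powR ?(ltW q_gt1)// subr_ge0.
  rewrite lee_pmul2l ?lte_fin ?q_gt0//.
  have U0 : U !=set0 by exists x; exact: Vx.1.
  rewrite /diameter_pow ifF; last by apply/negP => /eqP U0'; move: U0; rewrite U0' => -[].
  apply: (@le_trans _ _ ((q ^- n.+1) `^ s)%:E).
    rewrite lee_fin; apply: ger_powR => //.
    by rewrite invr_gt0 exprn_gt0 ?q_gt0//= invf_le1 ?exprn_gt0 ?q_gt0//
      exprn_ege1// ltW// q_gt1.
  rewrite -poweR_EFin; apply: gt0_ler_poweR => //.
  - by rewrite in_itv /= leey lee_fin invr_ge0 exprn_ge0 ?(ltW q_gt0).
  - by rewrite in_itv /= leey diameter_ge0.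
  - apply: (@le_trans _ _ (mdist x y)%:E).
      by rewrite lee_fin; apply: lnorm_ge_digit; rewrite digitB subr_eq0.
    by apply: ereal_sup_ubound; exists (x, y) => //; split; [exact: Vx.1|exact: Vy.1].
have [l /(_ l (leqnn l)) lP] := powR_geo_small q_gt1 s'0 e0.
have [[x Vx]|V0] := pselect (V !=set0); last first.
  exists l, (fun=> 0); split; first by move=> x Vx; case: V0; exists x.
  apply: (@le_trans _ _ e%:E); first by rewrite lee_fin.
  by rewrite leeDr// mule_ge0 ?diameter_pow_ge0// lee_fin (ltW q_gt0).
exists l, (digit x); split; last first.
  apply: (@le_trans _ _ e%:E); first by rewrite lee_fin.
  by rewrite leeDr// mule_ge0 ?diameter_pow_ge0// lee_fin (ltW q_gt0).
move=> z Vz; split; first exact: Vz.2.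
apply/agreeP => i _; apply: contrapT => /eqP zxi; apply: same; exists i.
by apply/asboolP; exists z, x.
Qed.

(** The bound on the number of cylinders is real, so that counts such as q^t (1 - q^-w)^j need no
    truncated subtraction. *)
Definition covered (E : set (laurent_space R F)) n (c : R) :=
  exists2 us : seq (nat -> F), (size us)%:R <= c &
    forall x, E x -> exists2 u, u \in us & cylinder n u x.

Definition extend n u (a : seq F) i := if (i < n)%N then u i else a`_(i - n).

Definition window n w u : w.-tuple F := [tuple u (n + i)%N | i < w].

Lemma agree_extend n w u v : agree n v u -> agree (n + w) v (extend n u (window n w v)).
Proof.
move=> /agreeP vu; apply/agreeP => i inw; rewrite /extend.
case: ltnP => [|ni]; first exact: vu.
have h : (i - n < w)%N by lia.
by rewrite -(tnth_nth _ _ (Ordinal h)) tnth_mktuple /= subnKC.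
Qed.

Lemma covered_refine E n w c K (C : (nat -> F) -> seq (w.-tuple F)) :
  covered E n c -> (forall u, (size (C u) = K)%N) ->
  (forall x u, E x -> agree n (digit x) u -> window n w (digit x) \in C u) ->
  covered E (n + w) (c * K%:R).
Proof.
move=> [us usc usE] CK CE.
exists (flatten [seq [seq extend n u (val a) | a <- C u] | u <- us]).
  rewrite (_ : size _ = (size us * K)%N) ?natrM ?ler_wpM2r//.
  by elim: (us) => //= u us' IH; rewrite size_cat size_map CK IH mulSn.
move=> x Ex; have [u us_u [x1 xu]] := usE _ Ex.
exists (extend n u (window n w (digit x))); last by split=> //; exact: agree_extend.
apply/flattenP; exists [seq extend n u (val a) | a <- C u].
  by apply/mapP; exists u.
by apply/mapP; exists (window n w (digit x)) => //; exact: CE.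
Qed.

Lemma covered_extend E n w c : covered E n c -> covered E (n + w) (c * q ^+ w).
Proof.
move=> Ec; rewrite -natrX.
apply: (covered_refine (C := fun=> enum {: w.-tuple F})) => // [u|x u _ _].
  by rewrite -cardE card_tuple.
by rewrite mem_enum.
Qed.

Lemma covered_unit E n : E `<=` [set x | lnorm R x < 1] -> covered E n (q ^+ n).
Proof.
move=> E1; rewrite -[n]add0n -[q ^+ _]mul1r; apply: covered_extend.
exists [:: fun=> 0] => // x /E1 x1; exists (fun=> 0); first by rewrite inE.
by split=> //; apply/agreeP.
Qed.

(** Among the q^w continuations of each prefix u, the one prescribed by the forbidden v is
    dropped. *)
Lemma covered_avoid E n w c :
  (forall u, exists2 v, agree n u v & forall x, E x -> ~~ agree (n + w) (digit x) v) ->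
  covered E n c -> covered E (n + w) (c * (q ^+ w - 1)).
Proof.
move=> H Ec; pose P u v := agree n u v /\
  forall x, E x -> ~~ agree (n + w) (digit x) v.
have [f fP] : {f & forall u, P u (f u)}.
  by apply: (@choice _ _ P) => u; have [v] := H u; exists v.
rewrite (_ : q ^+ w - 1 = (#|F| ^ w - 1)%:R); last first.
  by rewrite natrB ?natrX// expn_gt0 (ltnW (card_finNzRing_gt1 F)).
apply: (covered_refine (C := fun u => rem (window n w (f u)) (enum {: w.-tuple F})))
  => // [u|x u Ex xu].
  by rewrite size_rem ?mem_enum// -cardE card_tuple subn1.
rewrite mem_rem_uniq ?enum_uniq// inE mem_enum andbT.
apply/negP => /eqP e; have /negP := (fP u).2 x Ex; apply.
have := agree_extend w (agree_trans xu (fP u).1); rewrite e.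
move=> /agree_trans; apply; rewrite agreeC; apply: agree_extend.
by apply/agreeP.
Qed.

(** Covers by cylinders of a single level suffice: n >= n0 brings the diameters below delta, and
    each cylinder costs at most (q^-n)^s. *)
Lemma hausdorff_measure_null (E : set (laurent_space R F)) (s : R) : 0 <= s ->
  (forall (e : R) n0, 0 < e -> exists n c,
     [/\ (n0 <= n)%N, covered E n c & c * (q ^- n) `^ s <= e]) ->
  hausdorff_measure s E = 0%E.
Proof.
move=> s0 H; apply/eqP; rewrite eq_le hausdorff_measure_ge0 andbT.
apply: ge_ereal_sup => _ [delta d0 <-]; apply/lee_addgt0Pr => e e0; rewrite add0e.
have [n0 n0d] : exists n0, q ^- n0 < delta.
  have [n0 _ /(_ n0 (leqnn _))] : \forall n \near \oo, q ^- n < delta.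
    have : (fun n => q^-1 ^+ n) @ \oo --> (0 : R).
      by apply: cvg_expr; rewrite gtr0_norm ?invr_gt0// invf_lt1.
    move=> /cvgr0_norm_lt /(_ _ d0); apply: filterS => n.
    by rewrite gtr0_norm ?exprn_gt0 ?invr_gt0// exprVn.
  by exists n0.
have [n [c [n0n [us usc usE] ce]]] := H e n0 e0.
(* The finite cover is padded with empty sets, for which [diameter_pow] is 0 by convention. *)
pose U i := if (i < size us)%N then cylinder n (nth (fun=> 0) us i) else set0.
apply: (@le_trans _ _ (\sum_(0 <= i <oo) diameter_pow s (U i))%E).
  apply: ereal_inf_lbound; exists U => //; split.
    move=> x /usE[u uus xu]; exists (index u us) => //.
    by rewrite /U index_mem uus nth_index.
  move=> i; rewrite /U; case: ifP => _; last first.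
    by apply: ge_ereal_sup => _ [? [[]]].
  apply: le_trans (diameter_cylinder _ _) _; rewrite lee_fin.
  apply: le_trans _ (ltW n0d); rewrite lef_pV2 ?posrE ?exprn_gt0//.
  by rewrite ler_weXn2l// ltW.
rewrite (nneseries_split _ (size us)); last by move=> i _; exact: diameter_pow_ge0.
rewrite [X in (_ + X)%E]eseries0 ?adde0; last first.
  by move=> i; rewrite /= add0n /U /diameter_pow leqNgt => /negbTE -> _; rewrite eqxx.
apply: (@le_trans _ _ (\sum_(0 <= i < 0 + size us) ((q ^- n) `^ s)%:E)%E).
  rewrite big_nat [leRHS]big_nat; apply: lee_sum => i /andP[_ ius]; rewrite /U ius.
  exact: diameter_pow_cylinder.
rewrite sumEFin sumr_const_nat subn0 add0n -[_ *+ size us]mulr_natl lee_fin.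
by apply: le_trans _ ce; rewrite ler_wpM2r// powR_ge0.
Qed.

(** Each window of w digits multiplies the surviving proportion by 1 - q^-w; digits between
    consecutive windows are left free. *)
Lemma covered_avoid_seq E w (t : nat -> nat) j :
  E `<=` [set x | lnorm R x < 1] -> (forall j, (t j + w <= t j.+1)%N) ->
  (forall j u, exists2 v, agree (t j) u v &
     forall x, E x -> ~~ agree (t j + w) (digit x) v) ->
  covered E (t j) (q ^+ t j * (1 - q ^- w) ^+ j).
Proof.
move=> E1 tw H; elim: j => [|j IHj]; first by rewrite mulr1; exact: covered_unit.
have := covered_extend (t j.+1 - (t j + w)) (covered_avoid (H j) IHj).
rewrite subnKC//; congr covered.
rewrite -[t j.+1 in RHS](subnKC (tw j)) !exprD exprSr.
have qw : q ^+ w != 0 by rewrite expf_neq0// gt_eqF.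
by field.
Qed.

(** With rho = 1 - q^-w, the cover of level t_j costs (q^(t_j))^(1-s) rho^j <= C^(1-s) (B^(1-s)
    rho)^j, which tends to 0 along the j with q^(t_j) <= C B^j. *)
Lemma hausdorff_measure_avoid (E : set (laurent_space R F)) w (t : nat -> nat)
    (B C s : R) :
  E `<=` [set x | lnorm R x < 1] -> (0 < w)%N -> (forall j, (t j + w <= t j.+1)%N) ->
  (forall j u, exists2 v, agree (t j) u v &
     forall x, E x -> ~~ agree (t j + w) (digit x) v) ->
  0 < B -> 0 < C -> 0 <= s -> s < 1 -> B `^ (1 - s) * (1 - q ^- w) < 1 ->
  (forall J, exists2 j, (J <= j)%N & q ^+ t j <= C * B ^+ j) ->
  hausdorff_measure s E = 0%E.
Proof.
move=> E1 w0 tw H B0 C0 s0 s1 Br tB; apply: hausdorff_measure_null => // e n0 e0.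
set rho := 1 - q ^- w in Br *.
have rho0 : 0 <= rho.
  by rewrite subr_ge0 invf_le1 ?exprn_gt0// exprn_ege1// ltW.
set z := B `^ (1 - s) * rho in Br.
have z0 : 0 <= z by rewrite mulr_ge0 ?powR_ge0.
have [J JP] : exists J, forall j, (J <= j)%N -> C `^ (1 - s) * z ^+ j <= e.
  have : (fun j => C `^ (1 - s) * z ^+ j) @ \oo --> (0 : R).
    rewrite -(mulr0 (C `^ (1 - s))); apply: cvgMr; apply: cvg_expr.
    by rewrite ger0_norm.
  move=> /cvgr0_norm_lt /(_ _ e0) [J _ JP]; exists J => j /JP.
  by rewrite /= ger0_norm ?mulr_ge0 ?exprn_ge0 ?powR_ge0// => /ltW.
have [j Jj tj] := tB (maxn J n0).
exists (t j), (q ^+ t j * rho ^+ j); split.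
- have tge : forall i, (i <= t i)%N.
    by elim=> // i IHi; apply: leq_trans (tw i); lia.
  by apply: leq_trans (tge j); apply: leq_trans Jj; exact: leq_maxr.
- exact: covered_avoid_seq.
- apply: le_trans (JP j _); last by apply: leq_trans Jj; exact: leq_maxl.
  set y := q ^+ t j in tj *; have y0 : 0 < y by rewrite exprn_gt0.
  have -> : y * rho ^+ j * y^-1 `^ s = y `^ (1 - s) * rho ^+ j.
    rewrite -(powR_inv1 (ltW y0)) -powRrM mulN1r mulrAC; congr (_ * _).
    by rewrite -[X in X * _](powRr1 (ltW y0)) -powRD// (gt_eqF y0) implybT.
  have -> : C `^ (1 - s) * z ^+ j = (C * B ^+ j) `^ (1 - s) * rho ^+ j.
    rewrite /z exprMn powRM ?exprn_ge0 ?(ltW B0) ?(ltW C0)// -mulrA.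
    congr (_ * (_ * _)).
    by rewrite -(powR_mulrn j (powR_ge0 B _)) -(powR_mulrn j (ltW B0)) -!powRrM mulrC.
  rewrite ler_wpM2r ?exprn_ge0// ge0_ler_powR ?nnegrE ?subr_ge0 ?(ltW s1) ?(ltW y0)//.
  by rewrite mulr_ge0 ?exprn_ge0 ?ltW.
Qed.

End Digits.

(** * Mass distribution: lower bounds for Hausdorff measures *)

Section MassDistribution.
Variables (R : realType) (F : finFieldType).
Local Notation q := (#|F|%:R : R).
Local Notation q_gt0 := (card_gt0R R F).
Local Notation q_gt1 := (card_gt1R R F).
Variables (ok : nat -> (nat -> F) -> pred F) (r : nat -> nat).
Hypothesis ok_agree : forall n u v, agree n u v -> ok n u =1 ok n v.
Hypothesis r_gt0 : forall n, (0 < r n)%N.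
Hypothesis card_ok : forall n u, (r n <= #|ok n u|)%N.

(** A lower bound for the number of admissible prefixes of length n; 1 / m n stands for the mass of
    a cylinder of level n. *)
Let m n : R := \prod_(i < n) (r i)%:R.

Let m_gt0 n : 0 < m n.
Proof. by apply: prodr_gt0 => i _; rewrite ltr0n. Qed.

Let upd (u : nat -> F) n a i := if i == n then a else u i.

Let agree_upd n u v a : agree n.+1 v (upd u n a) = agree n v u && (v n == a).
Proof.
apply/agreeP/andP => [vu|[/agreeP vu /eqP va] i].
  split; last by rewrite vu// /upd eqxx.
  apply/agreeP => i ni; have -> := vu i (ltnW ni).
  by rewrite /upd (ltn_eqF ni).
rewrite ltnS leq_eqVlt => /orP[/eqP ->|ni]; rewrite /upd ?eqxx//.
by rewrite ltn_eqF// vu.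
Qed.

(* Greedy choice of digits: the total weight of the cylinders contained in the
   current one stays below the share kappa / m n of that cylinder. *)
Lemma escape_cylinders (l : nat -> nat) (v : nat -> nat -> F) (e : nat -> R) (kappa : R) :
  (forall i, 0 <= e i) -> (forall i, kappa / m (l i) <= e i) ->
  (\sum_(0 <= i <oo) (e i)%:E < kappa%:E)%E ->
  exists2 b, (forall n, ok n b (b n)) & forall i, ~~ agree (l i) b (v i).
Proof.
move=> e0 le_e sum_e.
have kappa_ge0 : 0 <= kappa.
  rewrite -lee_fin; apply: le_trans (ltW sum_e).
  by apply: nneseries_ge0 => i _ _; rewrite lee_fin.
pose term n u i := if (n <= l i)%N && agree n (v i) u then e i else 0.
have term_ge0 n u i : 0 <= term n u i by rewrite /term; case: ifP.
pose W n u := (\sum_(0 <= i <oo) (term n u i)%:E)%E.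
(* A cylinder strictly inside the current one lies in exactly one of its children. *)
have term_upd n u i : \sum_(a | ok n u a) term n.+1 (upd u n a) i <= term n u i.
  apply: (@le_trans _ _ (\sum_a term n.+1 (upd u n a) i)).
    by rewrite big_mkcond; apply: ler_sum => a _; case: ifP.
  rewrite (bigD1 (v i n))//= big1 ?addr0 => [|a /negbTE vna].
    rewrite /term agree_upd eqxx andbT; case: ifP => [/andP[/ltnW -> ->]//|_].
    exact: term_ge0.
  by rewrite /term agree_upd eq_sym vna !andbF.
have step nu : exists a, (W nu.1 nu.2 < (kappa / m nu.1)%:E)%E ->
    ok nu.1 nu.2 a /\ (W nu.1.+1 (upd nu.2 nu.1 a) < (kappa / m nu.1.+1)%:E)%E.
  case: nu => n u /=; have [Wu|] := pselect (W n u < (kappa / m n)%:E)%E;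
    last by exists 0.
  suff [a [oka Wa]] : exists a, ok n u a /\ (W n.+1 (upd u n a) < (kappa / m n.+1)%:E)%E.
    by exists a.
  (* Pigeonhole: if every allowed digit led to a child of weight at least kappa / m (n+1), these
     children, at least r n in number, would together weigh at least kappa / m n. *)
  apply: contrapT => /forallNP none; move: Wu; apply/negP; rewrite -leNgt.
  apply: (@le_trans _ _ (\sum_(a | ok n u a) W n.+1 (upd u n a))%E); last first.
    rewrite /W -nneseries_sum; last by move=> a i _; rewrite lee_fin.
    apply: lee_nneseries => [i _ _|i _].
      by apply: sume_ge0 => a _; rewrite lee_fin.
    by rewrite sumEFin lee_fin.
  apply: (@le_trans _ _ (\sum_(a | ok n u a) (kappa / m n.+1)%:E)%E); last first.
    by apply: lee_sum => a oka; rewrite leNgt; apply/negP => Wa; apply: (none a).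
  rewrite sumEFin lee_fin sumr_const -mulr_natr.
  apply: (@le_trans _ _ (kappa / m n.+1 * (r n)%:R)).
    by rewrite {2}/m big_ord_recr /= -/(m n) invfM mulrA mulfVK// pnatr_eq0 -lt0n.
  by rewrite ler_wpM2l ?ler_nat ?card_ok// divr_ge0// ltW.
have {step} [f fP] := choice step.
pose u := fix u n := if n is n'.+1 then upd (u n') n' (f (n', u n')) else fun=> 0.
pose b n := f (n, u n).
have uP n : agree n (u n) b.
  elim: n => [|n IHn]; first exact/agreeP.
  by rewrite agreeC /= agree_upd agreeC IHn eqxx.
have Wu n : (W n (u n) < (kappa / m n)%:E)%E.
  elim: n => [|n IHn]; last exact: ((fP (n, u n) IHn).2).
  rewrite /m big_ord0 divr1; apply: le_lt_trans sum_e.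
  apply: lee_nneseries => [i _ _|i _]; first by rewrite lee_fin.
  by rewrite lee_fin /term; case: ifP.
exists b => [n|i].
  by rewrite -(ok_agree (uP n)); exact: ((fP (n, u n) (Wu n)).1).
(* Had b entered the i-th cylinder, that cylinder alone would contribute e i >= kappa / m (l i) at
   level l i, against [Wu]. *)
apply/negP => bv; have := Wu (l i); apply/negP; rewrite -leNgt.
apply: (@le_trans _ _ (term (l i) (u (l i)) i)%:E).
  by rewrite lee_fin /term leqnn agreeC (agree_trans (uP _) bv).
have := @nneseries_lim_ge R (fun j => (term (l i) (u (l i)) j)%:E) xpredT 0 i.+1.
rewrite big_nat_recr//= => /(_ (fun _ _ _ => ltac:(by rewrite lee_fin)))/(le_trans _).
by apply; rewrite leeDr// sume_ge0// => j _; rewrite lee_fin.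
Qed.

(** A null K would have a cover of cost below eta. Cylinders enclosing the covering sets then weigh
    less than kappa in total, and an admissible sequence escaping all of them is a point of K
    outside the cover. *)
Lemma hausdorff_measure_neq0 (K : set (laurent_space R F)) (s s' kappa : R) :
  0 <= s <= s' -> 0 < s' <= 1 -> 0 < kappa ->
  (forall n, kappa / m n <= (q ^- n) `^ s') ->
  (forall x, lnorm R x < 1 -> (forall n, ok n (digit x) (digit x n)) -> K x) ->
  hausdorff_measure s K != 0%E.
Proof.
move=> ss' s'01 kappa0 kappam KP; apply/eqP => K0.
(* Chosen so that q eta + eta = kappa: the first term comes from the cost of the cover, the second
   from the errors eta / 2^(i+1). *)
set eta := kappa / (q + 1).
have eta0 : 0 < eta by rewrite divr_gt0// addr_gt0// q_gt0.
have : (hausdorff_premeasure s 1 K < eta%:E)%E.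
  apply: le_lt_trans (_ : (_ <= 0)%E) _; last by rewrite lte_fin.
  by rewrite -K0; apply: ereal_sup_ubound; exists 1 => /=.
move=> /ereal_inf_lt[_ [U [KU _] <-] Ueta].
have lv i : exists lv : nat * (nat -> F),
    U i `&` [set x | lnorm R x < 1] `<=` cylinder lv.1 lv.2 /\
    (((q ^- lv.1) `^ s')%:E <= q%:E * diameter_pow s (U i) + (eta / (2 ^ i.+1)%:R)%:E)%E.
  have ei : 0 < eta / (2 ^ i.+1)%:R by rewrite divr_gt0// ltr0n expn_gt0.
  by have [l [v h]] := cylinder_of_diameter (U i) ss' s'01 ei; exists (l, v).
have [g gP] := choice lv.
have [|||b okb bv] := @escape_cylinders (fun i => (g i).1) (fun i => (g i).2)
  (fun i => (q ^- (g i).1) `^ s') kappa.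
- by move=> i; exact: powR_ge0.
- by move=> i; exact: kappam.
- have q0 : (0 <= q%:E)%E by rewrite lee_fin (ltW q_gt0).
  apply: (@le_lt_trans _ _ (\sum_(0 <= i <oo) (q%:E * diameter_pow s (U i) +
    (eta / (2 ^ i.+1)%:R)%:E))%E).
    apply: lee_nneseries => i; first by rewrite lee_fin powR_ge0.
    by move=> _; exact: (gP i).2.
  apply: le_lt_trans (epsilon_trick _ _ (ltW eta0)) _.
    by move=> i; rewrite mule_ge0// diameter_pow_ge0.
  rewrite nneseriesZl; last by move=> i _; exact: diameter_pow_ge0.
  have -> : kappa = q * eta + eta.
    have q1 : q + 1 != 0 by rewrite gt_eqF// addr_gt0// q_gt0.
    by rewrite /eta; field.
  by rewrite EFinD lteD2rE// EFinM lte_pmul2l// lte_fin q_gt0.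
- pose x := laurent_of_digits b.
  have x1 : lnorm R x < 1 by apply/lnorm_lt1 => -[].
  have [i _ Uix] : (\bigcup_i U i) x by apply: KU; apply: KP.
  have /negP := bv i; apply.
  by have [] := (gP i).1 x (conj Uix x1).
Qed.

End MassDistribution.

(** * Approximation by multiples of alpha *)

Section Approximation.
Variables (R : realType) (F : finFieldType) (alpha : laurent F).
Hypothesis alpha_irr : laurent_irrational alpha.
Local Notation q := (#|F|%:R : R).
Local Notation q_gt0 := (card_gt0R R F).
Local Notation q_gt1 := (card_gt1R R F).
Local Notation Q := (cf_den alpha).
Local Notation d := (cf_deg alpha).

Lemma lnorm_poly (p : {poly F}) : p != 0 ->
  lnorm R (laurent_poly p) = q ^+ (size p).-1.
Proof.
move=> p0; have pd := exact_deg_poly p0; have p0' := exact_deg_neq0 pd.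
by rewrite /lnorm (negbTE p0') (exact_deg_inj (exact_deg_ldeg p0') pd).
Qed.

Lemma poly_dist_le (x : laurent F) n :
  (forall i, (i < n)%N -> digit x i = 0) -> poly_dist R x <= q ^- n.+1.
Proof.
move=> xn; apply: (@le_trans _ _ (lnorm R (fracl x))).
  apply: ge_inf; last by exists (poly_part x).
  by exists 0 => _ [p _ <-]; exact: lnorm_ge0.
apply: lnorm_le_digits; first exact: fracl_lbound.
by move=> i /xn; rewrite fracl_digit.
Qed.

Lemma poly_dist_ge (x : laurent F) n : digit x n != 0 -> q ^- n.+1 <= poly_dist R x.
Proof.
move=> xn; have [p ->] := poly_dist_attained R x.
by apply: lnorm_ge_digit; rewrite digitB digit_poly subr0.
Qed.

Lemma cf_degD k j : (d k + j <= d (k + j))%N.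
Proof.
elim: j => [|j IHj]; first by rewrite !addn0.
by rewrite !addnS; exact: leq_ltn_trans (cf_deg_lt alpha_irr _).
Qed.

Lemma leq_cf_deg2 k l : (k <= l)%N -> (d k <= d l)%N.
Proof. by move=> kl; have := cf_degD k (l - k); rewrite subnKC//; lia. Qed.

Lemma cf_deg_bracket n : exists l, (d l <= n < d l.+1)%N.
Proof.
elim: n => [|n [l /andP[ln nl]]].
  by exists 0%N; have := cf_deg_lt alpha_irr 0; rewrite cf_deg0.
have [h|h] := ltnP n.+1 (d l.+1); first by exists l; rewrite h ltnW.
by exists l.+1; rewrite h (leq_ltn_trans nl)// (cf_deg_lt alpha_irr).
Qed.

Lemma digit_polyXnM i (x : laurent F) n :
  digit (laurent_poly 'X^i * x) n = digit x (n + i).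
Proof.
rewrite digit_polyM size_polyXn big_ord_recr /= coefXn eqxx mul1r big1 ?add0r// => j _.
by rewrite coefXn ltn_eqF ?mul0r.
Qed.

Lemma digit_polyCM c (x : laurent F) n :
  digit (laurent_poly c%:P * x) n = c * digit x n.
Proof.
rewrite digit_polyM size_polyC; case: (eqVneq c 0) => [->|c0] /=.
  by rewrite big_ord0 mul0r.
by rewrite big_ord1 coefC addn0.
Qed.

(* The products 'X^i * cf_den l with 0 <= i < deg A_(l+1) multiply alpha to
   leading digits at every position, so digits can be prescribed greedily. *)
Lemma cf_digits_surj k n (u : nat -> F) : (n <= d k)%N ->
  exists2 p : {poly F}, (size p <= d k)%N & agree n (digit (laurent_poly p * alpha)) u.
Proof.
elim: n => [_|n IHn nk]; first by exists 0; rewrite ?size_poly0//; apply/agreeP.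
have [p pk /agreeP pu] := IHn (ltnW nk).
have [l /andP[ln nl]] := cf_deg_bracket n.
have lk : (d l.+1 <= d k)%N.
  apply: leq_cf_deg2; rewrite ltnNge; apply/negP => /leq_cf_deg2.
  by rewrite leqNgt (leq_ltn_trans ln).
(* Multiplication by z^i moves the first nonzero digit of Q_l alpha from position d_(l+1) - 1 to n;
   since d_l <= n, the degree of z^i Q_l stays below d_(l+1). *)
pose i := ((d l.+1).-1 - n)%N.
have [low top] := cf_rem_digits alpha_irr l.
pose b := digit (laurent_poly (Q l) * alpha) (d l.+1).-1.
pose a := (u n - digit (laurent_poly p * alpha) n) / b.
have digitE j : digit (laurent_poly (p + a%:P * ('X^i * Q l)) * alpha) j =
    digit (laurent_poly p * alpha) j + a * digit (laurent_poly (Q l) * alpha) (j + i).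
  rewrite laurent_polyD mulrDl digitD !laurent_polyM -[in LHS]mulrA; congr (_ + _).
  rewrite -[laurent_poly 'X^i * _ * _]mulrA.
  by rewrite digit_polyCM digit_polyXnM.
exists (p + a%:P * ('X^i * Q l)).
  apply: (leq_trans (size_polyD _ _)); rewrite geq_max pk /=.
  apply: (leq_trans (size_polyMleq _ _)); apply: leq_trans lk.
  have a1 : (size (a%:P : {poly F}) <= 1)%N by rewrite size_polyC leq_b1.
  have := size_polyMleq 'X^i (Q l).
  rewrite size_polyXn (size_cf_den alpha_irr) /= => sz.
  rewrite -subn1 leq_subLR; apply: leq_trans (leq_add a1 sz) _.
  by rewrite /i; move: ln nl; lia.
apply/agreeP => j; rewrite ltnS leq_eqVlt => /orP[/eqP ->|jn]; rewrite digitE.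
  rewrite /i subnKC; last by move: nl; lia.
  by rewrite /a divfK// addrC subrK.
by rewrite pu// low ?mulr0 ?addr0// /i; move: nl jn; lia.
Qed.

(** Adding Q_k raises too small a degree to d_k and, by [cf_rem_digits], leaves the first d_(k+1) -
    1 digits unchanged; this is why one digit is given up. *)
Lemma cf_digits_surj_large k (u : nat -> F) :
  exists2 p : {poly F}, (d k < size p <= d k.+1)%N &
    agree (d k.+1).-1 (digit (laurent_poly p * alpha)) u.
Proof.
have [p pk /agreeP pu] := cf_digits_surj u (leqnn (d k.+1)).
have dk := cf_deg_lt alpha_irr k.
have [h|h] := ltnP (d k) (size p).
  by exists p; [rewrite h | apply/agreeP => i id; apply: pu; lia].
have sz : size (Q k + p) = (d k).+1 by rewrite size_polyDl size_cf_den.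
exists (Q k + p); first by rewrite sz ltnSn.
apply/agreeP => i id; rewrite laurent_polyD mulrDl digitD.
by rewrite (proj1 (cf_rem_digits alpha_irr k))// add0r pu//; lia.
Qed.

(* Pairing Q_k with Q alpha - theta: for deg Q <= d_(k+1) - 2 digit 0 of
   Q Q_k alpha vanishes, so Q alpha - theta has a nonzero digit among the first
   d_k + 1. *)
Lemma Bad_of_residues (x : laurent_space R F) : lnorm R x < 1 ->
  (forall k, digit (laurent_poly (Q k) * x) 0 != 0) -> Bad (q ^- 2) alpha x.
Proof.
(* Threshold 0: the bound holds for every nonzero Q, not only in the limit. *)
move=> x1 xQ; split=> //; apply: le_trans (ereal_sup_ubound _); last by exists 0.
apply: le_ereal_inf_tmp => _ [p p0 <-]; rewrite lee_fin.
have {}p0 : p != 0.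
  by apply: contraTneq p0 => ->; rewrite /= laurent_poly0 lnorm0 ltxx.
rewrite lnorm_poly//; have sp : (0 < size p)%N by rewrite size_poly_gt0.
(* The size, one more than the degree, is bracketed, so that the digits of Q_k alpha at all j < size
   p vanish. *)
have [k /andP[kp pk]] := cf_deg_bracket (size p).
set y := laurent_poly p * alpha - x.
have : digit (laurent_poly (Q k) * y) 0 != 0.
  rewrite /y mulrBr digitB mulrCA digit_polyM big1 ?sub0r ?oppr_eq0// => j _.
  by rewrite (proj1 (cf_rem_digits alpha_irr k)) ?mulr0//; have := ltn_ord j; lia.
rewrite digit_polyM => yk.
have [j jk yj] : exists2 j, (j <= d k)%N & digit y j != 0.
  apply: contrapT => none; move/eqP: yk; apply; apply: big1 => j _.
  have [->|yj] := eqVneq (digit y j) 0; first by rewrite mulr0.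
  case: none; exists j => //; rewrite -ltnS -(size_cf_den alpha_irr); exact: ltn_ord.
(* A nonzero digit at a position at most deg p + 1 keeps the distance at least q^-(deg p + 2),
   whence the constant q^-2. *)
apply: (@le_trans _ _ (q ^+ (size p).-1 * q ^- (size p).+1)).
  rewrite (_ : (size p).+1 = ((size p).-1 + 2)%N); last by rewrite addn2 prednK.
  by rewrite (exprD q (size p).-1 2) (invfM (q ^+ (size p).-1)) mulrA
    divff ?mul1r// expf_neq0// gt_eqF ?q_gt0.
rewrite ler_wpM2l ?exprn_ge0 ?(ltW q_gt0)//; apply: le_trans _ (poly_dist_ge yj).
rewrite lef_pV2 ?posrE ?exprn_gt0 ?q_gt0// ler_weXn2l ?(ltW q_gt1)//.
by rewrite ltnS; exact: leq_trans kp.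
Qed.

End Approximation.

(** * Dimension less than 1 when the limit is not infinite *)

Section Forward.
Variables (R : realType) (F : finFieldType) (alpha : laurent F).
Hypothesis alpha_irr : laurent_irrational alpha.
Local Notation q := (#|F|%:R : R).
Local Notation q_gt0 := (card_gt0R R F).
Local Notation q_gt1 := (card_gt1R R F).
Local Notation d := (cf_deg alpha).

(** Fixing the threshold replaces the lower limit by a uniform condition; the countable union over M
    is handled by [hausdorff_measure_bigcup_null]. *)
Definition bad_above (c : R) M : set (laurent_space R F) :=
  [set x | lnorm R x < 1 /\ forall p : {poly F}, (M < size p)%N ->
     c < lnorm R (laurent_poly p) * poly_dist R (laurent_poly p * alpha - x)].

(** The strict inequality c < eps yields one threshold at which the infimum already exceeds c. *)
Lemma Bad_sub_bad_above (c eps : R) : c < eps ->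
  Bad eps alpha `<=` \bigcup_M bad_above c M.
Proof.
move=> ceps x [x1 xeps].
have : (c%:E < eps%:E)%E by rewrite lte_fin.
move=> /lt_le_trans /(_ xeps) /ereal_sup_gt[_ [N _ <-] cN].
have [M NM] : exists M, N < q ^+ M.
  exists (Num.bound `|N|); apply: le_lt_trans (ler_norm N) _.
  apply: lt_trans (archi_boundP (normr_ge0 _)) _.
  by rewrite -natrX ltr_nat ltn_expl// card_finNzRing_gt1.
exists M => //; split=> // p Mp.
have p0 : p != 0 by rewrite -size_poly_gt0; exact: leq_ltn_trans Mp.
rewrite -lte_fin; apply: lt_le_trans cN _; apply: ereal_inf_lbound; exists p => //=.
apply: (lt_le_trans NM); rewrite lnorm_poly// ler_weXn2l ?(ltW q_gt1)//.
by move: Mp; case: (size p).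
Qed.

(** A point sharing w further digits with p alpha, where deg p < d_(k+1), would make the product at
    most q^-w. Taking k = w j + M forces the size of p above M, and the step w keeps consecutive
    windows disjoint. *)
Lemma bad_above_avoid w M j (u : nat -> F) :
  exists2 v, agree (d (w * j + M).+1).-1 u v &
    forall x, bad_above (q ^- w) M x ->
      ~~ agree ((d (w * j + M).+1).-1 + w) (digit x) v.
Proof.
set k := (w * j + M)%N.
have [p /andP[kp pk] pu] := cf_digits_surj_large alpha_irr k u.
exists (digit (laurent_poly p * alpha)); first by rewrite agreeC.
move=> x [x1 xM]; apply/negP => /agreeP xp.
have p0 : (0 < size p)%N by exact: leq_ltn_trans kp.
have Mp : (M < size p)%N.
  apply: leq_ltn_trans kp; apply: leq_trans (leq_cf_deg alpha_irr k).
  exact: leq_addl.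
have := xM p Mp; apply/negP; rewrite -leNgt lnorm_poly -?size_poly_gt0//.
have pd : poly_dist R (laurent_poly p * alpha - x) <= q ^- ((d k.+1).-1 + w).+1.
  by apply: poly_dist_le => i id; rewrite digitB -xp// subrr.
apply: (@le_trans _ _ (q ^+ (d k.+1).-1 * q ^- ((d k.+1).-1 + w))); last first.
  rewrite (exprD q (d k.+1).-1 w) (invfM (q ^+ (d k.+1).-1)) mulrA divff ?mul1r//.
  by rewrite expf_neq0// gt_eqF ?q_gt0.
apply: ler_pM.
- by rewrite exprn_ge0 ?(ltW q_gt0).
- have [p' ->] := poly_dist_attained R (laurent_poly p * alpha - x); exact: lnorm_ge0.
- by rewrite ler_weXn2l ?(ltW q_gt1)//; lia.
- apply: le_trans pd _; rewrite lef_pV2 ?posrE ?exprn_gt0 ?q_gt0//.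
  by rewrite ler_weXn2l ?(ltW q_gt1).
Qed.

Lemma hausdorff_dim_Bad_lt1 (eps : R) : 0 < eps ->
  ~ ((fun k : nat => (lnorm R (laurent_poly (cf_den alpha k)) : R) `^ (k%:R^-1))
    @ \oo --> +oo) ->
  (hausdorff_dim (Bad eps alpha) < 1)%E.
Proof.
move=> eps0 /cvgryPge/existsNP[A0 nA].
pose A := Num.max 1 A0.
have A1 : 1 <= A by rewrite le_max lexx.
have A_gt0 : 0 < A by apply: lt_le_trans A1.
have dA J : exists2 k, (J <= k)%N & q ^+ d k <= A ^+ k.
  (* Starting at J + 1 excludes k = 0, where the exponent 1/k is 0 by convention. *)
  apply: contrapT => none; apply: nA; exists J.+1 => // k /= Jk.
  have k0 : 0 < k%:R :> R by rewrite ltr0n; exact: leq_ltn_trans Jk.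
  rewrite leNgt; apply/negP => kA; apply: none; exists k; first exact: ltnW.
  move: kA; rewrite lnorm_poly ?cf_den_neq0// -/(d k) => kA.
  have {kA} : (q ^+ d k) `^ k%:R^-1 <= A.
    by apply: le_trans (ltW kA) _; rewrite le_max lexx orbT.
  move=> /(ge0_ler_powR (ltW k0)); rewrite !nnegrE powR_ge0 (ltW A_gt0) => /(_ isT isT).
  by rewrite -powRrM mulVf ?gt_eqF// powRr1 ?exprn_ge0 ?(ltW q_gt0)// powR_mulrn// ltW.
have [w w0 weps] : exists2 w, (0 < w)%N & q ^- w < eps.
  have : (fun n => q^-1 ^+ n) @ \oo --> (0 : R).
    by apply: cvg_expr; rewrite gtr0_norm ?invr_gt0 ?invf_lt1 ?q_gt0 ?q_gt1.
  move=> /cvgr0_norm_lt /(_ _ eps0) [n _ /(_ n.+1 (leqnSn n)) /=].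
  rewrite gtr0_norm ?exprn_gt0 ?invr_gt0 ?q_gt0// exprVn => h.
  by exists n.+1.
have rho01 : 0 <= 1 - q ^- w < 1.
  have qw : 0 < q ^- w by rewrite invr_gt0 exprn_gt0// q_gt0.
  rewrite ltrBlDr ltrDl qw andbT subr_ge0 invf_le1 ?exprn_gt0 ?q_gt0//.
  by rewrite exprn_ege1// ltW// q_gt1.
have [s [s0 s1 Bs]] := exists_exponent_lt1 (exprn_ege1 w A1) rho01.
apply: (@le_lt_trans _ _ s%:E); last by rewrite lte_fin.
apply: ereal_inf_lbound; exists s => //; split=> //.
apply/eqP; rewrite eq_le hausdorff_measure_ge0 andbT.
apply: le_trans (hausdorff_measure_subset s (Bad_sub_bad_above weps)) _.
rewrite hausdorff_measure_bigcup_null// => M.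
(* One step of j advances w convergents, hence the base A^w; the factor A^(w+M+1) absorbs the shift
   by M + 1 and the remainder of the division by w. *)
apply: (@hausdorff_measure_avoid _ _ _ w (fun j => (d (w * j + M).+1).-1) (A ^+ w)
  (A ^+ (w + M).+1)) => //.
- by move=> x [].
- move=> j; have := cf_degD alpha_irr (w * j + M).+1 w.
  rewrite (_ : (w * j.+1 + M).+1 = ((w * j + M).+1 + w)%N); last by rewrite mulnS; lia.
  by have := cf_deg_lt alpha_irr (w * j + M); lia.
- by move=> j u; exact: bad_above_avoid.
- exact: exprn_gt0.
- exact: exprn_gt0.
- move=> J; have [k Jk kA] := dA (w * J + M).+1.
  exists ((k - M.+1) %/ w)%N; first by rewrite leq_divRL// mulnC; lia.
  set j := (_ %/ w)%N.
  have jk : ((w * j + M).+1 <= k)%N.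
    by have := leq_divM (k - M.+1) w; rewrite -/j mulnC; lia.
  apply: (@le_trans _ _ (q ^+ d k)).
    rewrite ler_weXn2l ?(ltW q_gt1)//.
    by apply: leq_trans (leq_pred _) _; exact: leq_cf_deg2.
  apply: (le_trans kA); rewrite -exprM -exprD ler_weXn2l//.
  by have := ltn_ceil (k - M.+1) w0; rewrite -/j mulSn mulnC; lia.
Qed.

End Forward.

(** The q^n cylinders of level n cost q^n (q^-n)^(1+e) = (q^-n)^e, which tends to 0. *)
Lemma hausdorff_dim_unit_le1 (R : realType) (F : finFieldType)
    (E : set (laurent_space R F)) :
  E `<=` [set x | lnorm R x < 1] -> (hausdorff_dim E <= 1)%E.
Proof.
move=> E1; apply/lee_addgt0Pr => e e0; apply: ereal_inf_lbound.
exists (1 + e) => //; split; first by rewrite addr_ge0// ltW.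
apply: hausdorff_measure_null => [|eta n0 eta0]; first by rewrite addr_ge0// ltW.
have [n1 n1P] := powR_geo_small (card_gt1R R F) e0 eta0.
exists (maxn n0 n1), (#|F|%:R ^+ maxn n0 n1); split; first exact: leq_maxl.
  exact: covered_unit.
set n := maxn n0 n1; have qn : 0 < #|F|%:R ^+ n :> R by rewrite exprn_gt0 ?card_gt0R.
have qV : 0 < (#|F|%:R ^+ n)^-1 :> R by rewrite invr_gt0.
rewrite powRD ?(gt_eqF qV) ?implybT//.
rewrite (powRr1 (ltW qV)) mulrA divff ?gt_eqF// mul1r.
by apply: n1P; exact: leq_maxr.
Qed.

(** * Dimension 1 when the limit is infinite *)

Section Backward.
Variables (R : realType) (F : finFieldType) (alpha : laurent F).
Hypothesis alpha_irr : laurent_irrational alpha.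
Local Notation q := (#|F|%:R : R).
Local Notation q_gt0 := (card_gt0R R F).
Local Notation q_gt1 := (card_gt1R R F).
Local Notation Q := (cf_den alpha).
Local Notation d := (cf_deg alpha).

Definition cf_position n := `[< exists k, d k = n >].

Definition cf_position_count n : nat := \sum_(i < n) cf_position i.

(** As d is strictly increasing, the count is the first index k with d_k >= n. *)
Lemma cf_position_countP n :
  (n <= d (cf_position_count n))%N /\
  forall k, (k < cf_position_count n)%N -> (d k < n)%N.
Proof.
elim: n => [|n [nd dn]]; first by rewrite /cf_position_count big_ord0.
rewrite /cf_position_count big_ord_recr /= -/(cf_position_count n).
set c := cf_position_count n in nd dn *.
rewrite /cf_position; case: asboolP => [[k kn]|nk].
  have -> : c = k.
    apply/eqP; rewrite eqn_leq; apply/andP; split; rewrite leqNgt; apply/negP.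
      by move=> /dn; rewrite kn ltnn.
    move=> ck; have := leq_cf_deg2 alpha_irr ck; rewrite kn.
    by have := cf_deg_lt alpha_irr c; lia.
  rewrite addn1; split; first by rewrite -kn cf_deg_lt.
  by move=> j; rewrite !ltnS => /(leq_cf_deg2 alpha_irr); rewrite kn.
rewrite addn0; split; last by move=> k /dn /ltnW.
by rewrite ltn_neqAle nd andbT; apply/eqP => e; apply: nk; exists c.
Qed.

(* Only a lower bound: at the positions deg Q_k all but one digit are allowed. *)
Definition num_children n := if cf_position n then 1%N else #|F|.

Lemma prod_num_children n :
  (\prod_(i < n) (num_children i)%:R) * q ^+ cf_position_count n = q ^+ n.
Proof.
rewrite /cf_position_count; elim: n => [|n IHn]; first by rewrite !big_ord0 mulr1.
rewrite !big_ord_recr /= exprD mulrACA IHn exprSr; congr (_ * _).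
by rewrite /num_children; case: (cf_position n); rewrite ?mul1r ?mulr1.
Qed.

(** The sum is digit 0 of Q_k theta for any theta whose digits begin with the first n of u followed
    by a. The leading coefficient is nonzero, so position d_k excludes exactly one a, and other
    positions none. *)
Definition avoids_residue n (u : nat -> F) : pred F := fun a =>
  `[< forall k, d k = n -> \sum_(j < n) (Q k)`_j * u j + lead_coef (Q k) * a != 0 >].

Lemma avoids_residue_agree n u v : agree n u v ->
  avoids_residue n u =1 avoids_residue n v.
Proof.
move=> /agreeP uv a; apply/asbool_equiv_eq.
by split=> H k kn; have := H k kn; congr (_ + _ != 0); apply: eq_bigr => j _; rewrite uv.
Qed.

Lemma cf_deg_inj : injective d.
Proof.
move=> k l kl; apply/eqP; rewrite eqn_leq; apply/andP.
by split; rewrite leqNgt; apply/negP => /(leq_cf_deg2 alpha_irr);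
  have := cf_deg_lt alpha_irr k;
  have := cf_deg_lt alpha_irr l; lia.
Qed.

Lemma card_avoids_residue n u : (num_children n <= #|avoids_residue n u|)%N.
Proof.
rewrite /num_children /cf_position; case: asboolP => [[k kn]|nk]; last first.
  rewrite [X in (_ <= X)%N](_ : _ = #|F|)//; apply: eq_card => a.
  by rewrite !inE; apply/asboolP => k kn; case: nk; exists k.
(* This digit makes the residue equal to 1. *)
apply/card_gt0P; exists ((1 - \sum_(j < n) (Q k)`_j * u j) / lead_coef (Q k)).
apply/asboolP => l; rewrite -kn => /cf_deg_inj ->; rewrite kn.
rewrite mulrC divfK ?lead_coef_eq0 ?cf_den_neq0// addrC subrK.
exact: oner_neq0.
Qed.

Lemma Bad_of_avoids_residue (x : laurent_space R F) : lnorm R x < 1 ->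
  (forall n, avoids_residue n (digit x) (digit x n)) -> Bad (q ^- 2) alpha x.
Proof.
move=> x1 xok; apply: Bad_of_residues => // k.
have /asboolP/(_ k erefl) := xok (d k).
by rewrite digit_polyM size_cf_den// big_ord_recr.
Qed.

(** Eventually the k-th root of the norm of Q_k is at least q^(1/t), that is k <= t d_k; for the
    last d_k below n this bounds the count by t n up to a constant. *)
Lemma cf_position_count_le (t : R) : 0 < t ->
  (fun k : nat => (lnorm R (laurent_poly (cf_den alpha k)) : R) `^ (k%:R^-1))
    @ \oo --> +oo ->
  exists2 c : R, 0 < c & forall n, q ^+ cf_position_count n <= c * (q ^+ n) `^ t.
Proof.
move=> t0 /cvgryPge /(_ (q `^ t^-1)) [k0 _ k0P].
have kP k : (k0 <= k)%N -> q ^+ k <= (q ^+ d k) `^ t.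
  move=> k0k; have [->|k_gt0] := posnP k.
    by rewrite expr0 cf_deg0 expr0 powR1.
  have k0' : 0 < k%:R :> R by rewrite ltr0n.
  have := k0P k k0k; rewrite /= lnorm_poly ?cf_den_neq0// -/(d k).
  have tk : 0 <= t * k%:R by rewrite mulr_ge0// ltW.
  move=> /(ge0_ler_powR tk); rewrite !nnegrE !powR_ge0 => /(_ isT isT).
  rewrite -!powRrM mulrA mulVf ?gt_eqF// mul1r mulrCA mulVf ?gt_eqF// mulr1.
  by rewrite powR_mulrn// ltW ?q_gt0.
(* This constant bounds the counts up to k0 + 1; for a larger count k + 1, a single factor q passes
   to the index k. *)
exists (q ^+ k0.+1) => [|n]; first by rewrite exprn_gt0 ?q_gt0.
have [nd dn] := cf_position_countP n.
have qn : 1 <= q ^+ n by rewrite exprn_ege1 ?(ltW q_gt1).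
have qnt : 1 <= (q ^+ n) `^ t.
  by have := ge0_ler_powR (ltW t0) _ _ qn; rewrite !nnegrE powR1;
    apply; rewrite ?(le_trans ler01).
have [cn|cn] := leqP (cf_position_count n) k0.+1.
  rewrite -[leLHS]mulr1; apply: ler_pM => //.
  by rewrite ler_weXn2l ?(ltW q_gt1).
move: cn dn; case: (cf_position_count n) => // k; rewrite ltnS => k0k dn.
rewrite exprS; apply: ler_pM; rewrite ?exprn_ge0 ?(ltW q_gt0)//.
  by rewrite -[leLHS]expr1 ler_weXn2l ?(ltW q_gt1).
apply: le_trans (kP k (ltnW k0k)) _; apply: ge0_ler_powR;
  rewrite ?nnegrE ?(ltW t0) ?exprn_ge0 ?(ltW q_gt0)//.
by rewrite ler_weXn2l ?(ltW q_gt1)// ltnW// dn.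
Qed.

(** A null s-measure with s < 1 is refuted at an exponent s' strictly between s and 1: the
    restricted digits cost a factor at most c q^(n (1 - s')), so the prefix count is at least q^(n
    s') / c. *)
Lemma hausdorff_dim_Bad_eq1 :
  (fun k : nat => (lnorm R (laurent_poly (cf_den alpha k)) : R) `^ (k%:R^-1))
    @ \oo --> +oo ->
  hausdorff_dim (Bad (q ^- 2) alpha) = 1%E.
Proof.
move=> lim; apply/eqP; rewrite eq_le hausdorff_dim_unit_le1/=; last by move=> x [].
apply: le_ereal_inf_tmp => _ [s [s0 Bad0] <-]; rewrite lee_fin leNgt; apply/negP => s1.
pose s' := (1 + s) / 2.
have ss' : 0 <= s <= s' by rewrite s0 /s'; lra.
have s'01 : 0 < s' <= 1 by rewrite /s'; lra.
have t0 : 0 < 1 - s' by rewrite /s'; lra.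
have [c c0 cP] := cf_position_count_le t0 lim.
have kappa0 : 0 < c^-1 by rewrite invr_gt0.
have := @hausdorff_measure_neq0 R F _ num_children avoids_residue_agree _
  card_avoids_residue (Bad (q ^- 2) alpha) s s' c^-1 ss' s'01 kappa0.
rewrite Bad0 eqxx => H; suff : false by []; apply: H => [n|n|].
- by rewrite /num_children; case: ifP => // _; exact: ltnW (card_finNzRing_gt1 F).
- set m := \prod_(i < n) _; set y := q ^+ n.
  have y0 : 0 < y by rewrite exprn_gt0 ?q_gt0.
  have mc := prod_num_children n; rewrite -/m -/y in mc.
  have qc : 0 < q ^+ cf_position_count n by rewrite exprn_gt0 ?q_gt0.
  have m0 : 0 < m by move: y0; rewrite -mc pmulr_lgt0.
  have -> : y^-1 `^ s' = y^-1 * y `^ (1 - s').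
    rewrite -(powR_inv1 (ltW y0)) -powRrM mulN1r -powRD ?(gt_eqF y0) ?implybT//.
    by congr (_ `^ _); ring.
  have -> : m^-1 = y^-1 * q ^+ cf_position_count n.
    by rewrite -mc invfM divfK// gt_eqF.
  by rewrite mulrCA ler_pM2l ?invr_gt0// ler_pdivrMl// cP.
- exact: Bad_of_avoids_residue.
Qed.

End Backward.

Theorem theorem2p1 (R : realType) (F : finFieldType) (alpha : laurent F)
    (alpha_irr : laurent_irrational alpha) :
  (exists eps : R, 0 < eps /\ hausdorff_dim (Bad eps alpha) = 1%E) <->
  (fun k : nat => lnorm R (laurent_poly (cf_den alpha k)) `^ (k%:R^-1))
    @ \oo --> +oo.
Proof.
split=> [[eps [eps0 dim1]]|lim].
  apply: contrapT => /(hausdorff_dim_Bad_lt1 alpha_irr eps0).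
  by rewrite dim1 ltxx.
(* The same value q^-2 serves every alpha. *)
exists (#|F|%:R ^- 2); split; last exact: hausdorff_dim_Bad_eq1.
by rewrite invr_gt0 exprn_gt0 ?card_gt0R.
Qed.
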